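(* Fix $p>1$, $\nu$ with $1<\nu<p$, $\alpha\in(0,2\pi)$, $r_0>0$, $N\in\mathbb N$ and $T\in(N\alpha,(N+1)\alpha)$. Let $x(t)=(r(t),\theta(t))$ be the solution of the deterministic impulsive system, for $\varepsilon\in(0,1)$ let $X^\varepsilon_t=(R^\varepsilon_t,\Theta^\varepsilon_t)$ be the solution of the randomly perturbed impulsive system (without angular drift perturbation and with angular noise $\varepsilon^p\,dB_t$), and let $Z_t=(R^1_t,\Theta^1_t)$ be the fluctuation process, all as defined in the context. Then there is a constant $C>0$, not depending on $\varepsilon$, such that for all sufficiently small $\varepsilon\in(0,1)$, $$\mathbb E\left[d_{[0,T]}(X^\varepsilon,x+\varepsilon Z)\right]\le\begin{cases}C\,\varepsilon^\nu, & \text{when } \nu<p\le 2,\\ C\,\varepsilon^2, & \text{when } 2<\nu<p,\end{cases}$$ where $d_{[0,T]}$ is the Skorohod metric on $D([0,T];\mathbb R^2)$ defined in the context.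
   Context: Notation: for a function $y$ with one-sided limits, $y^+(t)=\lim_{s\searrow t}y(s)$ for $t\ge0$, $y^-(t)=\lim_{s\nearrow t}y(s)$ for $t>0$, $y^-(0)=y(0)$; for processes these are defined pathwise. Assumptions on the data. $b:\mathbb R\to\mathbb R$ is smooth and bounded with bounded first and second derivatives. The resetting function $h:[0,\infty)\to[0,\infty)$ is strictly increasing, differentiable, satisfies $h(0)=0$, and has continuous bounded derivatives. Deterministic system (in polar coordinates; impacts on $\{\theta=\alpha\}$ reset $(r,\alpha)$ to $(h(r),0)$; initial condition $(r_0,0)$). With $t_k=k\alpha$ for $k\ge0$, $(r(t),\theta(t))$ is the right-continuous function with left limits such that for $t\in[t_{k-1},t_k)$, $k\ge1$, $$r(t)=r^+(t_{k-1})+\int_{t_{k-1}}^t b(r(s))\,ds,\qquad \theta(t)=t-t_{k-1},$$ with $r^+(t_0)=r_0$ and $r^+(t_k)=h(r^-(t_k))$ for $k\ge1$. Stochastic system. $W,B$ are independent standard one-dimensional Brownian motions on a probability space $(\Omega,\mathscr F,\mathbb P)$. $(R^\varepsilon_t,\Theta^\varepsilon_t)$ is the process with right-continuous paths with left limits such that for $t\in[\tau^\varepsilon_{k-1},\tau^\varepsilon_k)$, $k\ge1$, $$R^\varepsilon_t=R^{\varepsilon,+}_{\tau^\varepsilon_{k-1}}+\int_{\tau^\varepsilon_{k-1}}^t b(R^\varepsilon_s)\,ds+\varepsilon(W_t-W_{\tau^\varepsilon_{k-1}}),\qquad \Theta^\varepsilon_t=(t-\tau^\varepsilon_{k-1})+\varepsilon^p(B_t-B_{\tau^\varepsilon_{k-1}}),$$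 where $\tau^\varepsilon_0=0$, $\tau^\varepsilon_k=\inf\{t>\tau^\varepsilon_{k-1}:\Theta^{\varepsilon,-}_t=\alpha\}$ for $k\ge1$, $R^{\varepsilon,+}_{\tau^\varepsilon_0}=r_0$, and $R^{\varepsilon,+}_{\tau^\varepsilon_k}=h(R^{\varepsilon,-}_{\tau^\varepsilon_k})$ for $k\ge1$. Fluctuation process. $\Theta^1_t\equiv0$, and $R^1_t$ is the process with right-continuous paths with left limits such that for $t\in[t_{k-1},t_k)$, $k\ge1$, $$R^1_t=R^{1,+}_{t_{k-1}}+\int_{t_{k-1}}^t b'(r(s))R^1_s\,ds+(W_t-W_{t_{k-1}}),$$ with $R^{1,+}_{0}=0$ and $R^{1,+}_{t_k}=h'(r^-(t_k))R^{1,-}_{t_k}$ for $k\ge1$ (same Brownian motion $W$ as in $R^\varepsilon$). Skorohod metric. $D([0,T];\mathbb R^2)$ is the set of right-continuous functions $[0,T]\to\mathbb R^2$ with left limits. Let $\Lambda_T$ be the set of strictly increasing continuous bijections $\lambda$ of $[0,T]$ with $\gamma_T(\lambda):=\sup_{0\le s<t\le T}\left|\log\frac{\lambda(t)-\lambda(s)}{t-s}\right|<\infty$. Then $$d_{[0,T]}(x_1,x_2)=\inf_{\lambda\in\Lambda_T}\left\{\gamma_T(\lambda)\vee\sup_{0\le t\le T}|x_1(t)-x_2(\lambda(t))|\right\}.$$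
   Formalization: The perturbed radius can be negative at an impact, where h is undefined; so h is taken as an arbitrary extension to all of ℝ, twice continuously differentiable with bounded first and second derivatives; monotonicity, sign and h(0)=0 are required only on [0,∞). *)

(* Defs.v *)
From HB Require Import structures.
From mathcomp Require Import all_boot all_order all_algebra.
From mathcomp Require Import all_classical all_reals all_analysis.

Set Implicit Arguments.
Unset Strict Implicit.
Unset Printing Implicit Defensive.

Import Order.TTheory GRing.Theory Num.Theory.
Import numFieldNormedType.Exports.

Local Open Scope classical_set_scope.
Local Open Scope ring_scope.

(* Time runs over [0, +oo[; a path is a function on the whole of R whose values
   at negative times are never used. *)

Section Data.
Context {R : realType}.
Implicit Types b h : R -> R.

Definition bounded_fct (f : R -> R) : Prop := exists M, forall x, `|f x| <= M.

Definition drift_function b : Prop :=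
  [/\ forall n x, derivable (derive1n n b) x 1,
      bounded_fct b, bounded_fct (derive1n 1 b) & bounded_fct (derive1n 2 b)].

(* The resetting map is a function on [0, +oo[, but the perturbed radius is
   negative with positive probability at an impact.  So h stands for an
   arbitrary extension to R of the resetting map, which keeps its regularity
   (every C^2 function on [0, +oo[ with bounded first and second derivatives
   has such an extension); monotonicity and sign are only required on
   [0, +oo[. *)
Definition reset_function h : Prop :=
  [/\ {in `[0, +oo[ &, {homo h : x y / x < y}},
      h 0 = 0,
      forall x, 0 <= x -> 0 <= h x &
      forall n, (n < 2)%N ->
        [/\ forall x, derivable (derive1n n h) x 1,
            continuous (derive1n n.+1 h) & bounded_fct (derive1n n.+1 h)]].

End Data.

Section Paths.
Context {R : realType}.
Implicit Types (b h y w beta r theta : R -> R) (t alpha eps p : R).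

Definition right_lim y t : R := lim (y s @[s --> t^'+]).

Definition left_lim y t : R :=
  if t == 0 then y 0 else lim (y s @[s --> t^'-]).

Definition cadlag y : Prop :=
  (forall t, 0 <= t -> y s @[s --> t^'+] --> y t) /\
  (forall t, 0 < t -> cvg (y s @[s --> t^'-])).

Definition deterministic_solution b h alpha (r0 : R) r theta : Prop :=
  [/\ cadlag r /\ cadlag theta,
      right_lim r 0 = r0,
      forall k : nat, right_lim r (k.+1%:R * alpha) =
                      h (left_lim r (k.+1%:R * alpha)) &
      forall (k : nat) t, k%:R * alpha <= t < k.+1%:R * alpha ->
        r t = right_lim r (k%:R * alpha) +
              \int[lebesgue_measure]_(s in `[k%:R * alpha, t]) b (r s) /\
        theta t = t - k%:R * alpha].

(* +oo when the path theta has fewer than k impacts *)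
Fixpoint impact_time alpha theta (k : nat) : \bar R :=
  if k is k'.+1 then
    ereal_inf [set t%:E | t in
      [set t | (impact_time alpha theta k' < t%:E)%E /\
               left_lim theta t = alpha]]
  else 0%E.

(* One path (r, theta) of the perturbed system, driven by the paths w and beta
   of the two Brownian motions.  The right limit of theta expresses the
   initial condition (r0, 0) and the reset of (_, alpha) to (h _, 0); it forces
   successive impact times to be distinct. *)
Definition perturbed_solution b h alpha (r0 : R) p eps w beta r theta : Prop :=
  let tau := impact_time alpha theta in
  [/\ cadlag r /\ cadlag theta,
      right_lim r 0 = r0,
      forall k : nat, (tau k < +oo)%E -> right_lim theta (fine (tau k)) = 0,
      forall k : nat, (tau k.+1 < +oo)%E ->
        right_lim r (fine (tau k.+1)) = h (left_lim r (fine (tau k.+1))) &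
      forall (k : nat) t, (tau k <= t%:E < tau k.+1)%E ->
        let u := fine (tau k) in
        r t = right_lim r u +
              \int[lebesgue_measure]_(s in `[u, t]) b (r s) +
              eps * (w t - w u) /\
        theta t = (t - u) + eps `^ p * (beta t - beta u)].

Definition fluctuation_solution b h alpha r w (r1 : R -> R) : Prop :=
  [/\ cadlag r1,
      right_lim r1 0 = 0,
      forall k : nat, right_lim r1 (k.+1%:R * alpha) =
        derive1 h (left_lim r (k.+1%:R * alpha)) *
        left_lim r1 (k.+1%:R * alpha) &
      forall (k : nat) t, k%:R * alpha <= t < k.+1%:R * alpha ->
        r1 t = right_lim r1 (k%:R * alpha) +
               \int[lebesgue_measure]_(s in `[k%:R * alpha, t])
                 (derive1 b (r s) * r1 s) +
               (w t - w (k%:R * alpha))].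

End Paths.

Section Skorohod.
Context {R : realType}.
Implicit Types (T : R) (lam : R -> R).

Definition plane : lmodType R := (R^o * R^o)%type.

(* the library's norm on a product is the maximum norm *)
Definition euclidean_norm (u : plane) : R := Num.sqrt (u.1 ^+ 2 + u.2 ^+ 2).

Definition planar_path (r theta : R -> R) : R -> plane :=
  fun t => (r t, theta t).

Definition time_distortion T lam : \bar R :=
  ereal_sup [set z | exists s t, [/\ 0 <= s, s < t, t <= T &
                     z = `|ln ((lam t - lam s) / (t - s))|%:E]].

Definition time_changes T : set (R -> R) :=
  [set lam | [/\ {in `[0, T] &, {homo lam : s t / s < t}},
                 {within `[0, T], continuous lam},
                 set_bij `[0, T] `[0, T] lam &
                 (time_distortion T lam < +oo)%E]].

Definition skorohod T (x1 x2 : R -> plane) : \bar R :=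
  ereal_inf [set maxe (time_distortion T lam)
                      (ereal_sup [set (euclidean_norm (x1 t - x2 (lam t)))%:E
                                 | t in `[0, T]])
            | lam in time_changes T].

End Skorohod.

Section Brownian.
Context {d : measure_display} {Omega : measurableType d} {R : realType}.
Variable P : probability Omega R.
Implicit Types W B : R -> {RV P >-> R}.

Definition increment W (s t : R) : Omega -> R := fun w => W t w - W s w.

Definition independent_increments W : Prop :=
  forall (n : nat) (t : nat -> R) (A : nat -> set R),
    0 <= t 0%N -> {homo t : i j / (i <= j)%N >-> i <= j} ->
    (forall i, measurable (A i)) ->
    P (\bigcap_(i < n) (increment W (t i) (t i.+1) @^-1` A i)) =
    (\prod_(i < n) P (increment W (t i) (t i.+1) @^-1` A i))%E.

Definition gaussian_increments W : Prop :=
  forall s t (A : set R), 0 <= s -> s < t -> measurable A ->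
    P (increment W s t @^-1` A) = normal_prob 0 (Num.sqrt (t - s)) A.

Definition brownian_motion W : Prop :=
  [/\ {ae P, forall w, W 0 w = 0},
      independent_increments W,
      gaussian_increments W &
      {ae P, forall w, {within `[0, +oo[, continuous (fun t => W t w)}}].

Definition process_sigma_algebra W : set (set Omega) :=
  <<s [set E | exists t (A : set R),
         [/\ 0 <= t, measurable A & E = W t @^-1` A] ] >>.

Definition independent_processes W B : Prop :=
  forall E F, process_sigma_algebra W E -> process_sigma_algebra B F ->
    P (E `&` F) = (P E * P F)%E.

End Brownian.

(* Main.v *)
Require Import Defs.
From HB Require Import structures.
From mathcomp Require Import all_boot all_order all_algebra.
From mathcomp Require Import all_classical all_reals all_analysis.
From mathcomp Require Import measurable_realfun.
From mathcomp Require Import lra.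

Set Implicit Arguments.
Unset Strict Implicit.
Unset Printing Implicit Defensive.

Import Order.TTheory GRing.Theory Num.Theory.
Import numFieldNormedType.Exports.

Local Open Scope classical_set_scope.
Local Open Scope ring_scope.

(** The comparison is made one realization at a time; probability enters only
    through a number [K] such that both Brownian paths are [gamma]-Hoelder on
    [0, T] with constant [K], for a fixed [gamma < 1/2].

    The angle has unit drift, so the [k]-th impact happens at a time [t] with
    [t + eps^p (beta t - beta 0) = k alpha] (lemma [perturbed_segments]), hence
    within [del = O(eps^p K)] of the deterministic impact time [k alpha].  When
    [del] is small compared with [alpha] and with the distance from [T] to the
    nearest multiples of [alpha], there are exactly [N] impacts before [T].
    The piecewise affine time change which matches the two sequences of impacts
    has slopes within [O(del)] of 1, which bounds its distortion
    ([skorohod_retiming]).  Along this time change the difference between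
    [R^eps] and [r + eps R^1] has three sources ([comparison_bound]): the
    second order Taylor remainders of [b] and [h], of size [(eps K)^2]; the
    slopes, of size [eps^p K]; and the noise, which is read at two times [O(del)]
    apart and contributes [eps K (eps^p K)^gamma].  A Gronwall inequality with
    jumps ([jump_gronwall]) propagates these errors through the [N] resets.

    When [del] is not small, both paths are bounded separately.  The perturbed
    path may then have a number of impacts proportional to [K], and the bound
    is exponential in [K]; but [1 <= O(del)] provides the missing factor
    [eps^p].  In both cases the distance is at most
    [C (eps^p + eps^2 + eps^(1 + p gamma)) exp (c K)] ([pathwise_bound]), and
    [exp (c K)] is integrable by Gaussian chaining along the dyadic times
    ([brownian_holder_constant]).

    It remains to choose [gamma]: [1 + p gamma = nu] if [p <= 2], where
    [nu < p <= 2] makes [gamma < 1/2], and [1 + p gamma = 2] if [2 < p]. *)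

(** * Cadlag paths and integral equations *)

Section Cadlag.
Context {R : realType}.
Implicit Types (g y w : R -> R) (P : R -> Prop) (s t u v : R).

Lemma near_rightP P t : (\forall s \near t^'+, P s) <->
  exists2 e : R, 0 < e & forall s, t < s -> s < t + e -> P s.
Proof.
split=> [[e /= e0 H]|[e e0 H]].
  exists e => // s ts st; apply: H => //=.
  by rewrite distrC gtr0_norm ?subr_gt0// ltrBlDl.
exists e => //= s /=; rewrite distrC => + ts.
by rewrite gtr0_norm ?subr_gt0// ltrBlDl; exact: H.
Qed.

Lemma near_leftP P t : (\forall s \near t^'-, P s) <->
  exists2 e : R, 0 < e & forall s, t - e < s -> s < t -> P s.
Proof.
split=> [[e /= e0 H]|[e e0 H]].
  exists e => // s ts st; apply: H => //=.
  by rewrite gtr0_norm ?subr_gt0// ltrBlDl -ltrBlDr.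
exists e => //= s /= + st.
by rewrite gtr0_norm ?subr_gt0// ltrBlDl -ltrBlDr => ts; exact: H.
Qed.

Lemma nbhs_sidesP P t : P t -> (\forall s \near t^'-, P s) ->
  (\forall s \near t^'+, P s) -> \forall s \near t, P s.
Proof.
move=> Pt /near_leftP[e e0 He] /near_rightP[d d0 Hd].
exists (Num.min e d) => /=; first by rewrite lt_min e0 d0.
move=> s /=; rewrite lt_min => /andP[h1 h2].
have [st|ts|->//] := ltgtP s t.
  apply: He => //; move: h1; rewrite gtr0_norm ?subr_gt0//.
  by rewrite ltrBlDl -ltrBlDr.
by apply: Hd => //; move: h2; rewrite distrC gtr0_norm ?subr_gt0// ltrBlDl.
Qed.

(** The one-sided limits bound [g] near each point, and finitely many such
    neighbourhoods cover a compact interval. *)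
Lemma cadlag_bounded g u v : cadlag g -> 0 <= u ->
  exists M : R, forall s, u <= s <= v -> `|g s| <= M.
Proof.
move=> [gr gl] u0.
have /compact_near_coveringP /(_ R (+oo)%R (fun M x => u <= x -> `|g x| <= M)) :=
  @segment_compact R u v.
case.
- move=> x; rewrite /= in_itv/= => /andP[ux xv].
  have x0 : 0 <= x by exact: le_trans ux.
  pose l := lim (g s @[s --> x^'-]).
  pose M0 : R := `|g x| + `|l| + 1.
  suff H : \forall x' \near x, u <= x' -> `|g x'| <= M0.
    exists ([set x' | u <= x' -> `|g x'| <= M0], [set M | M0 <= M]) => /=.
      by split => //=; apply: nbhs_pinfty_ge; rewrite num_real.
    by move=> [a b]/= [h1 h2] /h1 h; exact: le_trans h h2.
  apply: nbhs_sidesP.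
  + by move=> _; rewrite /M0 -addrA lerDl addr_ge0.
  + move: ux; rewrite le_eqVlt => /predU1P[<-|ux].
      by apply/near_leftP; exists 1 => // s _ su us; move: (lt_le_trans su us); rewrite ltxx.
    have := gl _ (le_lt_trans u0 ux) => /cvgr_norm_le /(_ M0).
    have lM : `|l| < M0 by rewrite /M0 addrAC ltrDr ltr_wpDl.
    by move=> /(_ lM); apply: filterS => s h _.
  + have /cvgr_norm_le /(_ M0) := gr _ x0.
    have lM : `|g x| < M0 by rewrite /M0 -addrA ltrDl ltr_wpDl.
    by move=> /(_ lM); apply: filterS => s h _.
- move=> M [_ H]; exists (M + 1 : R) => s /andP[us sv].
  by apply: (H (M + 1)); rewrite ?ltrDl//= in_itv/= us sv.
Qed.

(** The path is the pointwise limit of the step functions which read it at the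
    next point, to the right, of the grid of mesh 1/(n+1). *)
Lemma right_continuous_measurable g :
  (forall t, 0 <= t -> g s @[s --> t^'+] --> g t) ->
  measurable_fun (`[0, +oo[%classic : set R) g.
Proof.
move=> gr; pose k (n : nat) t := Num.truncn (n.+1%:R * t).
apply: (@measurable_fun_cvg _ _ _ _
  (fun n t => g ((k n t).+1%:R / n.+1%:R))).
- move=> n _ Y mY; rewrite [X in measurable X](_ : _ =
    \bigcup_(j in [set j | Y (g (j.+1%:R / n.+1%:R))])
       `[j%:R / n.+1%:R, j.+1%:R / n.+1%:R[%classic).
    by apply: bigcup_measurable => j _; exact: measurable_itv.
  have n0 : 0 < n.+1%:R :> R by rewrite ltr0n.
  apply/seteqP; split => [t /= []|t [j /= Yj]].
    rewrite in_itv/= andbT => t0 Yt; exists (k n t) => //=.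
    rewrite in_itv/= ler_pdivrMr// ltr_pdivlMr// ![t * _]mulrC.
    by apply: truncn_itv; exact: mulr_ge0.
  rewrite in_itv/= ler_pdivrMr// ltr_pdivlMr// ![t * _]mulrC => jt.
  split.
    rewrite in_itv/= andbT; case/andP: jt => jt _.
    by rewrite -(pmulr_rge0 _ n0) (le_trans _ jt)// ler0n.
  by rewrite /= /k (truncn_def jt).
- move=> t /=; rewrite in_itv/= andbT => t0.
  move: (gr _ t0) => /cvg_at_rightP; apply; split.
    move=> n; rewrite ltr_pdivlMr ?ltr0n// mulrC.
    by have /andP[] := @truncn_itv R (n.+1%:R * t) (mulr_ge0 (ler0n _ _) t0).
  apply: (@squeeze_cvgr _ _ _ _ (cst t) (fun n => t + n.+1%:R^-1)).
  + apply: nearW => n /=; have n0 : 0 < n.+1%:R :> R by rewrite ltr0n.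
    have /andP[h1 h2] := @truncn_itv R (n.+1%:R * t) (mulr_ge0 (ler0n _ _) t0).
    rewrite ler_pdivlMr// mulrC (ltW h2)/= ler_pdivrMr// mulrDl mulVf ?gt_eqF//.
    by rewrite -natr1 lerD2r mulrC.
  + exact: cvg_cst.
  + rewrite -[X in _ --> X]addr0; apply: cvgD; first exact: cvg_cst.
    exact: cvg_harmonic.
Qed.

Lemma cadlag_integrable g u v : cadlag g -> 0 <= u ->
  (@lebesgue_measure R).-integrable `[u, v] (EFin \o g).
Proof.
move=> cg u0; apply: measurable_bounded_integrable => //.
- exact/compact_finite_measure/segment_compact.
- apply: measurable_funS (right_continuous_measurable cg.1) => //.
  by move=> s /=; rewrite !in_itv/= andbT => /andP[us _]; exact: le_trans us.
- have [M HM] := cadlag_bounded v cg u0.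
  exists M; split; rewrite ?num_real// => N MN s /=; rewrite in_itv/= => /HM.
  by move=> h; exact: le_trans h (ltW MN).
Qed.

(** Once the noise is subtracted an integral remains: it is continuous and,
    where the integrand is continuous, differentiable.  All later estimates
    differentiate such noiseless paths only. *)
Lemma driven_path_continuous y g w (a c : R) u v : 0 <= u -> u < v ->
    cadlag g -> {within `[0, +oo[, continuous w} ->
    (forall s, u <= s <= v ->
      y s = a + \int[lebesgue_measure]_(x in `[u, s]) g x + c * (w s - w u)) ->
  {within `[u, v], continuous (fun s => y s - c * w s)} /\
  {within `[u, v], continuous y}.
Proof.
move=> u0 uv cg cw H.
have cw' : {within `[u, v], continuous (fun s => c * w s)}.
  have : {within `[u, v], continuous w}.
    apply: continuous_subspaceW cw => s /=.
    by rewrite !in_itv/= andbT => /andP[us _]; exact: le_trans us.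
  by move=> h s; apply: continuousM; [exact: cst_continuous|exact: h].
have cF : {within `[u, v], continuous (fun s => y s - c * w s)}.
  have := parameterized_integral_continuous (ltW uv) (cadlag_integrable v cg u0).
  move=> /(within_continuousD (f := cst (a - c * w u))) h.
  apply: subspace_eq_continuous (h _) => [s|s].
    rewrite inE/= in_itv/= => /H; rewrite /from_subspace /= => ->.
    by rewrite /parameterized_integral !fctE /cst; lra.
  exact: cst_continuous.
split => //.
apply: subspace_eq_continuous (within_continuousD cF cw') => s _.
by rewrite /from_subspace /= fctE; lra.
Qed.

Lemma driven_path_derive y g w (a c : R) u v s : 0 <= u -> u < s < v ->
    cadlag g -> {for s, continuous g} ->
    (forall s, u <= s <= v ->
      y s = a + \int[lebesgue_measure]_(x in `[u, s]) g x + c * (w s - w u)) ->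
  is_derive s 1 (fun s => y s - c * w s) (g s).
Proof.
move=> u0 /andP[us sv] cg gs H.
have [d1 d2] := continuous_FTC1_closed sv (cadlag_integrable v cg u0) us gs.
pose F (x : R) := \int[lebesgue_measure]_(t in `[u, x]) g t.
have dF : is_derive s 1 F (g s).
  apply: DeriveDef; first exact: d1.
  exact: (etrans (esym (derive1E _ _)) d2).
have dF' : is_derive s 1 (fun x => (a - c * w u) + F x) (g s).
  apply: (is_derive_eq (is_deriveD (is_derive_cst (a - c * w u) _ _) dF)).
  by rewrite add0r.
refine (@near_eq_is_derive _ _ _ (fun x => (a - c * w u) + F x) _ s 1 _ _ dF').
near=> x; rewrite H; last first.
  apply/andP; split; apply: ltW; near: x; [exact: lt_nbhsr|exact: lt_nbhsl].
by rewrite /F; lra.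
Unshelve. all: by end_near. Qed.

(** * Growth estimates, with and without jumps *)

(** With [m = 2 L + 1], the function [(F^2 + k^2) exp (- m s)] is nonincreasing,
    since [2 F F' <= 2 L F^2 + 2 k |F|] and [2 k |F| <= F^2 + k^2].  Squares
    avoid differentiating an absolute value. *)
Lemma gronwall_derive (F dF : R -> R) u v (L k : R) : u <= v -> 0 <= L -> 0 <= k ->
    {within `[u, v], continuous F} ->
    (forall s, u < s < v -> is_derive s 1 F (dF s)) ->
    (forall s, u < s < v -> `|dF s| <= L * `|F s| + k) ->
  `|F v| <= (`|F u| + k) * expR ((2 * L + 1) * (v - u)).
Proof.
move=> uv L0 k0 cF dFE dFL.
pose m := 2 * L + 1.
have m0 : 0 <= m by rewrite /m; lra.
pose H := (fun s => F s * F s + k * k) * (fun s => expR (- m * s)).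
have dexp s : is_derive s 1 (fun s => expR (- m * s)) (- m * expR (- m * s)).
  have h : is_derive s 1 (fun s => - m * s) (- m).
    apply: (is_derive_eq (is_deriveZ (- m) (is_derive_id s (1 : R)))).
    by rewrite /GRing.scale/= mulr1.
  by apply: is_derive_eq (is_derive1_comp (is_derive_expR _) h) _; rewrite mulrC.
have dH s : u < s < v -> is_derive s 1 H
    ((2 * F s * dF s - m * (F s * F s + k * k)) * expR (- m * s)).
  move=> sv; have := dFE s sv => h.
  have h1 : is_derive s 1 (fun s => F s * F s + k * k) (2 * F s * dF s).
    apply: (is_derive_eq (is_deriveD (is_deriveM h h) (is_derive_cst (k * k) _ _))).
    by rewrite /GRing.scale/=; lra.
  apply: is_derive_eq (is_deriveM h1 (dexp s)) _.
  by rewrite /GRing.scale/=; lra.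
have neg s : u < s < v ->
    (2 * F s * dF s - m * (F s * F s + k * k)) * expR (- m * s) <= 0.
  move=> sv; rewrite pmulr_lle0 ?expR_gt0//.
  have h1 : 2 * F s * dF s <= 2 * `|F s| * (L * `|F s| + k).
    rewrite -!mulrA ler_pM2l ?ltr0n//; apply: le_trans (ler_norm _) _.
    by rewrite normrM ler_wpM2l// dFL.
  have h2 : F s * F s = `|F s| * `|F s| by rewrite -normrM ger0_norm// sqr_ge0.
  have h3 : 0 <= (`|F s| - k) ^+ 2 by exact: sqr_ge0.
  rewrite h2 /m; nra.
have cH : {within `[u, v], continuous H}.
  move=> x; apply: continuousM; last first.
    apply: continuous_subspaceT => s.
    by apply: differentiable_continuous; apply/derivable1_diffP; case: (dexp s).
  by apply: continuousD; [apply: continuousM; exact: cF|exact: cst_continuous].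
have Hvu : H v <= H u.
  apply: (@ler0_derive1_le_cc _ H u v) => //; rewrite ?in_itv/= ?lexx ?uv//.
  - by move=> x; rewrite in_itv/= => /dH h; exact: ex_derive.
  - by move=> x; rewrite in_itv/= => xuv; have h := dH x xuv; rewrite derive1E derive_val neg.
have : `|F v| ^+ 2 <= ((`|F u| + k) * expR (m * (v - u))) ^+ 2.
  rewrite real_normK ?num_real//.
  have : F v ^+ 2 <= (F u ^+ 2 + k ^+ 2) * expR (m * (v - u)).
    have E : expR (m * (v - u)) = expR (- m * u) * expR (m * v).
      by rewrite -expRD; congr expR; lra.
    have E2 : expR (- m * v) * expR (m * v) = 1.
      by rewrite -expRD mulNr addNr expR0.
    rewrite E mulrA.
    apply: (@le_trans _ _ (H v * expR (m * v))).
      by rewrite /H fctE -mulrA E2 mulr1 -!expr2 lerDl sqr_ge0.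
    by rewrite ler_wpM2r ?expR_ge0// (le_trans Hvu)// /H fctE -!expr2.
  move=> /le_trans; apply; rewrite exprMn.
  have e1 : 1 <= expR (m * (v - u)).
    by rewrite -expR0 ler_expR mulr_ge0// subr_ge0.
  apply: ler_pM; rewrite ?addr_ge0 ?sqr_ge0 ?expR_ge0//.
    rewrite sqrrD real_normK ?num_real// addrAC lerDl.
    by rewrite mulrn_wge0// mulr_ge0.
  by rewrite expr2 ler_peMl ?expR_ge0.
by rewrite ler_sqr ?nnegrE ?mulr_ge0 ?addr_ge0 ?expR_ge0.
Qed.

(** The intermediate point is located by its distance to [y], which spares the
    distinction between [x <= y] and [y <= x]. *)
Lemma MVT_around (f : R -> R) (x y : R) : (forall z : R, derivable f z 1) ->
  exists2 c : R, `|c - y| <= `|x - y| & f x - f y = derive1 f c * (x - y).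
Proof.
move=> df.
have dfE (z : R) : is_derive z 1 f (derive1 f z) by apply: DeriveDef => //; rewrite derive1E.
have cf u v : {within `[u, v], continuous f}.
  apply: continuous_subspaceT => z.
  by apply: differentiable_continuous; exact/derivable1_diffP.
have [xy|/ltW yx] := leP x y.
  have [c] := MVT_segment xy (fun z _ => dfE z) (cf _ _).
  rewrite in_itv/= => /andP[xc cy] E; exists c.
    by rewrite !ler0_norm ?subr_le0// lerN2 lerD2r.
  by rewrite -opprB E -mulrN opprB.
have [c] := MVT_segment yx (fun z _ => dfE z) (cf _ _).
rewrite in_itv/= => /andP[yc cx] E; exists c => //.
by rewrite !ger0_norm ?subr_ge0// lerD2r.
Qed.

Lemma derive_bounded_lipschitz (f : R -> R) (L x y : R) :
    (forall z : R, derivable f z 1) -> (forall z, `|derive1 f z| <= L) ->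
  `|f x - f y| <= L * `|x - y|.
Proof.
move=> df fL; have [c _ ->] := MVT_around x y df.
by rewrite normrM ler_wpM2r.
Qed.

(** The Lipschitz bound replaces [x] by [y + z], and the expansion is made
    at [y].  In the applications [y] is the deterministic radius, [z] is [eps]
    times the fluctuation, and [x - y - z] is the error under study. *)
Lemma taylor_remainder (f : R -> R) (L M x y z : R) :
    (forall u : R, derivable f u 1) -> (forall u : R, derivable (derive1 f) u 1) ->
    (forall u, `|derive1 f u| <= L) -> (forall u, `|derive1 (derive1 f) u| <= M) ->
  `|f x - f y - derive1 f y * z| <= L * `|x - y - z| + M * z ^+ 2.
Proof.
move=> df ddf fL fM.
have M0 : 0 <= M by exact: le_trans (fM 0).
have -> : f x - f y - derive1 f y * z =
  (f x - f (y + z)) + (f (y + z) - f y - derive1 f y * z) by lra.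
apply: le_trans (ler_normD _ _) _; apply: lerD.
  by rewrite -addrA -opprD; exact: derive_bounded_lipschitz.
have [c] := MVT_around (y + z) y df.
rewrite addrAC subrr add0r => cz ->; rewrite -mulrBl normrM -real_normK ?num_real//.
rewrite expr2 mulrA ler_wpM2r//.
apply: le_trans (derive_bounded_lipschitz _ _ ddf fM) _.
by rewrite ler_wpM2l.
Qed.

(** The piece of [0, T] between two consecutive cuts; the last one, which starts
    at [sigma n], contains [T]. *)
Definition segment (sigma : nat -> R) (n : nat) (T : R) (k : nat) : set R :=
  [set t | sigma k <= t <= T /\ ((k < n)%N -> t < sigma k.+1)].

(** The term [L + 3] pays, in [jump_gronwall], for the passages between [D] and
    its differentiable approximation. *)
Definition gronwall_factor (L l : R) := (L + 3) * expR ((2 * L + 1) * l).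

Lemma gronwall_factor_ge0 L l : 0 <= L -> 0 <= gronwall_factor L l.
Proof. by move=> L0; rewrite /gronwall_factor mulr_ge0 ?expR_ge0//; lra. Qed.

(** [D k] is a difference of two paths on the [k]-th piece; it depends on [k]
    because every piece comes with its own change of time.  It is only within
    [kap] of a differentiable function [F], the same difference without noise.
    Each piece multiplies the error by at most [A], each jump by at most [Q], and
    both add a multiple of [kap]: the error is geometric in the number of
    pieces. *)
Lemma jump_gronwall (sigma : nat -> R) (n : nat) (D : nat -> R -> R) (T L Q kap l : R) :
    0 <= L -> 0 <= Q -> 0 <= kap ->
    (forall k t, (k <= n)%N -> segment sigma n T k t -> t - sigma k <= l) ->
    `|D 0%N (sigma 0%N)| <= kap ->
    (forall k (a : R), (k < n)%N -> (forall t, segment sigma n T k t -> `|D k t| <= a) ->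
      `|D k.+1 (sigma k.+1)| <= Q * a + kap) ->
    (forall k t, (k <= n)%N -> segment sigma n T k t -> exists F dF : R -> R,
      [/\ {within `[sigma k, t], continuous F},
          forall s, sigma k <= s <= t -> `|D k s - F s| <= kap,
          forall s, sigma k < s < t -> is_derive s 1 F (dF s) &
          forall s, sigma k < s < t -> `|dF s| <= L * `|D k s| + kap]) ->
  let A := gronwall_factor L l in
  forall k t, (k <= n)%N -> segment sigma n T k t ->
    `|D k t| <= 2 * A * (Q * A + 2) ^+ k * kap.
Proof.
move=> L0 Q0 kap0 len D0 jump piece A.
have A0 : 0 <= A by exact: gronwall_factor_ge0.
have onpiece k t : (k <= n)%N -> segment sigma n T k t ->
    `|D k t| <= A * (`|D k (sigma k)| + kap).
  move=> kn st; have [F [dF [cF DF dFE dFL]]] := piece k t kn st.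
  have kt : sigma k <= t by case: st => /andP[].
  have := @gronwall_derive F dF (sigma k) t L ((L + 1) * kap) kt L0.
  move=> /(_ _ cF dFE) G.
  have {}G : `|F t| <= (`|F (sigma k)| + (L + 1) * kap) * expR ((2 * L + 1) * (t - sigma k)).
    apply: G => [|s sk]; first by rewrite mulr_ge0//; lra.
    apply: le_trans (dFL s sk) _.
    have : `|D k s| <= `|F s| + kap.
      rewrite -lerBlDl; apply: le_trans (lerB_dist _ _) _; apply: DF.
      by case/andP: sk => /ltW -> /ltW ->.
    by move=> h; rewrite mulrDl mul1r addrA lerD2r -mulrDr ler_wpM2l.
  have h1 : `|D k t| <= `|F t| + kap.
    rewrite -lerBlDl; apply: le_trans (lerB_dist _ _) _; apply: DF.
    by rewrite kt lexx.
  have h2 : `|F (sigma k)| <= `|D k (sigma k)| + kap.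
    rewrite -lerBlDl; apply: le_trans (lerB_dist _ _) _; rewrite distrC; apply: DF.
    by rewrite kt lexx.
  have E1 : expR ((2 * L + 1) * (t - sigma k)) <= expR ((2 * L + 1) * l).
    by rewrite ler_expR ler_wpM2l ?len//; lra.
  have E2 : 1 <= expR ((2 * L + 1) * (t - sigma k)).
    by rewrite -{1}expR0 ler_expR mulr_ge0 ?subr_ge0//; lra.
  apply: le_trans h1 _; rewrite /A /gronwall_factor.
  set e1 := expR _ in E1 E2 G; set e2 := expR _ in E1 *.
  apply: (@le_trans _ _ ((`|D k (sigma k)| + kap + (L + 1) * kap) * e2 + kap * e2)).
    apply: lerD; last by rewrite ler_peMr// (le_trans E2).
    apply: le_trans G _; apply: ler_pM => //.
    - by rewrite addr_ge0// mulr_ge0//; lra.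
    - exact: expR_ge0.
    - by rewrite lerD2r.
  rewrite -mulrDl [(L + 3) * e2]mulrC -mulrA mulrC.
  rewrite ler_wpM2l ?expR_ge0//.
  have := normr_ge0 (D k (sigma k)); nra.
have B0 : 0 <= Q * A + 2 by rewrite addr_ge0// mulr_ge0.
have start k : (k <= n)%N -> `|D k (sigma k)| + kap <= 2 * (Q * A + 2) ^+ k * kap.
  elim: k => [_|k ih kn].
    by rewrite expr0 mulr1 mulrDl mul1r lerD2r.
  have := jump k (A * (`|D k (sigma k)| + kap)) kn (fun t st => onpiece k t (ltnW kn) st).
  move=> h; apply: (@le_trans _ _ ((Q * A + 2) * (`|D k (sigma k)| + kap))).
    have := normr_ge0 (D k (sigma k)); move: h; rewrite mulrA; nra.
  apply: le_trans (ler_wpM2l B0 (ih (ltnW kn))) _.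
  by rewrite exprS; lra.
move=> k t kn st; apply: le_trans (onpiece k t kn st) _.
apply: le_trans (ler_wpM2l A0 (start k kn)) _.
by lra.
Qed.

End Cadlag.

(** * Impact times of a perturbed path *)

Section ImpactTimes.
Context {R : realType}.
Implicit Types (y w beta r theta : R -> R) (s t u v alpha : R).

Lemma right_lim_cadlag y t : cadlag y -> 0 <= t -> right_lim y t = y t.
Proof. by move=> [yr _] t0; apply: cvg_lim; [exact: Rhausdorff|exact: yr]. Qed.

Lemma left_lim_cvg y t : cadlag y -> 0 < t -> y s @[s --> t^'-] --> left_lim y t.
Proof. by move=> [_ yl] t0; rewrite /left_lim gt_eqF//; exact: yl. Qed.

Lemma left_lim_unique y t (l : R) : 0 < t -> y s @[s --> t^'-] --> l ->
  left_lim y t = l.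
Proof.
by move=> t0 yl; rewrite /left_lim gt_eqF//; apply: cvg_lim; [exact: Rhausdorff|].
Qed.

Lemma left_lim_norm_le y u t (a : R) : cadlag y -> 0 <= u -> u < t ->
  (forall s, u <= s < t -> `|y s| <= a) -> `|left_lim y t| <= a.
Proof.
move=> cy u0 ut H; have t0 : 0 < t by exact: le_lt_trans ut.
apply: (cvgr_to_le (cvg_norm (left_lim_cvg cy t0))).
near=> s; apply: H; apply/andP; split; last by near: s; exact: nbhs_left_lt.
by near: s; exact: nbhs_left_ge.
Unshelve. all: by end_near. Qed.

(** No impact can follow immediately after a reset: the angle starts afresh
    from 0 and stays away from [alpha] for a while. *)
Lemma no_impact_after_reset theta u alpha : cadlag theta -> 0 <= u ->
    0 < alpha -> theta u = 0 ->
  exists2 e : R, 0 < e & forall t, u < t -> t < u + e -> left_lim theta t <> alpha.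
Proof.
move=> ct u0 a0 tu.
have /cvgr_le /(_ (alpha / 2)) := ct.1 u u0.
rewrite tu divr_gt0// => /(_ isT) /near_rightP[e e0 He]; exists e => // t ut te.
have t0 : 0 < t by exact: le_lt_trans ut.
have : left_lim theta t <= alpha / 2.
  have := left_lim_cvg ct t0; move=> /cvgr_to_le; apply.
  near=> s; apply: He; first by near: s; exact: nbhs_left_gt.
  apply: lt_trans te; near: s; exact: nbhs_left_lt.
by move=> h E; move: h; rewrite E; lra.
Unshelve. all: by end_near. Qed.

Lemma continuous_halfline_left w v : {within `[0, +oo[, continuous w} -> 0 < v ->
  w s @[s --> v^'-] --> w v.
Proof.
move=> /continuous_within_itvcyP[cw _] v0; apply: cvg_at_left_filter.
by apply: cw; rewrite in_itv/= andbT.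
Qed.

Lemma within_continuousM_cst (A : set R) (f : R -> R) (c : R) :
  {within A, continuous f} -> {within A, continuous (fun s => c * f s)}.
Proof. by move=> h s; apply: continuousM; [exact: cst_continuous|exact: h]. Qed.

Section PerturbedPath.
Variables (b h : R -> R) (alpha r0 p eps T H : R) (w beta r theta : R -> R).
Hypotheses (a0 : 0 < alpha) (T0 : 0 <= T).
Hypothesis cbeta : {within `[0, +oo[, continuous beta}.
Hypothesis betaH : forall s t, 0 <= s <= T -> 0 <= t <= T -> `|beta s - beta t| <= H.
Hypothesis sol : perturbed_solution b h alpha r0 p eps w beta r theta.

Let tau := impact_time alpha theta.
Let cr : cadlag r. Proof. by case: sol => [[]]. Qed.
Let ct : cadlag theta. Proof. by case: sol => [[]]. Qed.

Let tau_ge0 k : (0 <= tau k)%E.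
Proof.
elim: k => [//|k ih] /=; apply: le_ereal_inf_tmp => _ [t /= [kt _] <-].
exact: le_trans ih (ltW kt).
Qed.

Let tau_le k : (tau k <= tau k.+1)%E.
Proof. by apply: le_ereal_inf_tmp => _ [t /= [kt _] <-]; exact: ltW. Qed.

Let tau_homo k m : (k <= m)%N -> (tau k <= tau m)%E.
Proof.
elim: m => [|m ih]; first by rewrite leqn0 => /eqP ->.
rewrite leq_eqVlt => /predU1P[->//|]; rewrite ltnS => /ih /le_trans; apply.
exact: tau_le.
Qed.

Let tau_fin k : (tau k < +oo)%E -> tau k = (fine (tau k))%:E.
Proof. by move=> ?; rewrite fineK// ge0_fin_numE. Qed.

Let theta_reset k : (tau k < +oo)%E -> theta (fine (tau k)) = 0.
Proof.
move=> fk; rewrite -(right_lim_cadlag ct) ?fine_ge0//.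
by case: sol => _ _ /(_ k fk).
Qed.

Let tau_lt k : (tau k < +oo)%E -> (tau k < tau k.+1)%E.
Proof.
move=> fk; have u0 : 0 <= fine (tau k) by exact: fine_ge0.
have [e e0 He] := no_impact_after_reset ct u0 a0 (theta_reset fk).
apply: (@lt_le_trans _ _ (fine (tau k) + e)%:E).
  by rewrite {1}tau_fin// lte_fin ltrDl.
apply: le_ereal_inf_tmp => _ [t /= [kt lt] <-].
rewrite lee_fin leNgt; apply/negP => te; apply: (He t) => //.
have {}kt : (tau k < t%:E)%E := kt.
by rewrite -lte_fin -tau_fin.
Qed.

(** Impacts do not accumulate from the right, so the infimum is attained. *)
Let tau_attained k : (tau k.+1 < +oo)%E ->
  left_lim theta (fine (tau k.+1)) = alpha.
Proof.
move=> fk; set v := fine _; have v0 : 0 <= v by exact: fine_ge0.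
apply: contrapT => nv.
have [e e0 He] := no_impact_after_reset ct v0 a0 (theta_reset fk).
have : (tau k.+1 < (v + e)%:E)%E by rewrite tau_fin// lte_fin ltrDl.
move=> /ereal_inf_lt[_ [t /= [kt lt] <-]]; rewrite lte_fin => te.
have : (tau k.+1 <= t%:E)%E by apply: ereal_inf_lbound; exists t.
rewrite tau_fin// lee_fin le_eqVlt => /predU1P[vt|vt].
  by apply: nv; rewrite /v vt.
exact: (He t).
Qed.

Let angle u s := (s - u) + eps `^ p * (beta s - beta u).

Let angle_left u v : 0 <= u -> u < v -> angle u s @[s --> v^'-] --> angle u v.
Proof.
move=> u0 uv; have v0 : 0 < v by exact: le_lt_trans uv.
apply: cvgD; first by apply: cvgB; [exact: cvg_at_left_filter|exact: cvg_cst].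
apply: cvgM; first exact: cvg_cst.
by apply: cvgB; [exact: continuous_halfline_left|exact: cvg_cst].
Qed.

Let theta_formula k t : (tau k <= t%:E < tau k.+1)%E ->
  theta t = angle (fine (tau k)) t.
Proof. by move=> kt; case: sol => _ _ _ _ /(_ k t kt) []. Qed.

Let left_lim_formula k v : (tau k < v%:E)%E -> (v%:E <= tau k.+1)%E ->
  left_lim theta v = angle (fine (tau k)) v.
Proof.
move=> kv vk; have fk : (tau k < +oo)%E by exact: lt_trans kv (ltry _).
have u0 : 0 <= fine (tau k) by exact: fine_ge0.
have uv : fine (tau k) < v by rewrite -lte_fin -tau_fin.
apply: left_lim_unique; first exact: le_lt_trans uv.
apply: cvg_trans (angle_left u0 uv); apply: near_eq_cvg.
near=> s => /=; apply/esym/theta_formula; rewrite tau_fin// lee_fin; apply/andP; split.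
  by near: s; exact: nbhs_left_ge.
by apply: lt_le_trans vk; rewrite lte_fin; near: s; exact: nbhs_left_lt.
Unshelve. all: by end_near. Qed.

(** Between two impacts the angle climbs from 0 to [alpha]. *)
Let tau_sum k : (tau k < +oo)%E ->
  fine (tau k) + eps `^ p * (beta (fine (tau k)) - beta 0) = k%:R * alpha.
Proof.
elim: k => [_|k ih fk]; first by rewrite /= subrr mulr0 addr0 mul0r.
have fk' : (tau k < +oo)%E by exact: le_lt_trans (tau_le k) fk.
have := tau_attained fk; rewrite (@left_lim_formula k) -?tau_fin//; last exact: tau_lt.
by have := ih fk'; rewrite /angle -natr1; lra.
Qed.

(** An angle beyond [alpha] would have passed through [alpha] before, by the
    intermediate value theorem. *)
Let theta_lt k t : (tau k <= t%:E < tau k.+1)%E -> theta t < alpha.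
Proof.
move=> /andP[kt tk]; rewrite (@theta_formula k) ?kt//.
have fk : (tau k < +oo)%E by exact: le_lt_trans kt (ltry _).
set u := fine (tau k); have u0 : 0 <= u by exact: fine_ge0.
have ut : u <= t by rewrite -lee_fin -tau_fin.
rewrite ltNge; apply/negP => at_.
have cang : {within `[u, t], continuous angle u}.
  have cb : {within `[u, t], continuous beta}.
    apply: continuous_subspaceW cbeta => s /=.
    by rewrite !in_itv/= andbT => /andP[us _]; exact: le_trans us.
  have cid : {within `[u, t], continuous (fun s => s - u)}.
    by apply: continuous_subspaceT => y; apply: cvgB; [exact: cvg_id|exact: cvg_cst].
  have cb' : {within `[u, t], continuous (fun s => eps `^ p * (beta s - beta u))}.
    apply: within_continuousM_cst; apply: within_continuousB cb _.
    by move=> x; exact: cst_continuous.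
  exact: within_continuousD cid cb'.
have ang0 : angle u u = 0 by rewrite /angle !subrr mulr0 addr0.
have [] := IVT (v := alpha) ut cang.
  rewrite ang0; apply/andP; split; first by rewrite ge_min (ltW a0).
  by rewrite le_max at_ orbT.
move=> s; rewrite in_itv/= => /andP[us st] sa.
have {}us : u < s.
  rewrite lt_neqAle us andbT; apply/eqP => E.
  by move: sa; rewrite -E ang0 => E'; move: a0; rewrite -E' ltxx.
have : (tau k.+1 <= s%:E)%E.
  have ks : (tau k < s%:E)%E by rewrite tau_fin.
  apply: ereal_inf_lbound; exists s => //; split => //.
  rewrite -sa; apply: left_lim_formula => //; apply: ltW; apply: le_lt_trans tk.
  by rewrite lee_fin.
by rewrite leNgt (le_lt_trans _ tk)// lee_fin.
Qed.

(** The angles climbed sum to [k alpha] at the [k]-th impact, so the oscillation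
    of [beta] bounds the number of impacts before [T].  A perturbed path is thus
    reduced to finitely many cuts and one driven equation on each piece. *)
Lemma perturbed_segments : exists n (sigma : nat -> R),
  [/\ [/\ sigma 0%N = 0, forall k, (k < n)%N -> sigma k < sigma k.+1 & sigma n <= T],
      (forall k, (k <= n)%N ->
        sigma k + eps `^ p * (beta (sigma k) - beta 0) = k%:R * alpha),
      (forall k t, (k <= n)%N -> segment sigma n T k t ->
        t + eps `^ p * (beta t - beta 0) < k.+1%:R * alpha) &
      [/\ r 0 = r0,
        (forall k, (k < n)%N -> r (sigma k.+1) = h (left_lim r (sigma k.+1))) &
        (forall k t, (k <= n)%N -> segment sigma n T k t ->
          r t = r (sigma k) + \int[lebesgue_measure]_(s in `[sigma k, t]) b (r s)
                + eps * (w t - w (sigma k)) /\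
          theta t = (t - sigma k) + eps `^ p * (beta t - beta (sigma k)))]].
Proof.
have H0 : 0 <= H by apply: le_trans (betaH (s := 0) (t := 0) _ _); rewrite ?lexx.
pose bnd k := (tau k <= T%:E)%E.
have ex0 : exists k, bnd k by exists 0%N; rewrite /bnd /= lee_fin.
have ub k : bnd k -> (k <= Num.truncn ((T + eps `^ p * H) / alpha))%N.
  move=> kT; have fk : (tau k < +oo)%E by exact: le_lt_trans kT (ltry _).
  have u0 : 0 <= fine (tau k) by exact: fine_ge0.
  have uT : fine (tau k) <= T by rewrite -lee_fin -tau_fin.
  rewrite truncn_ge_nat ?divr_ge0 ?(ltW a0) ?addr_ge0 ?mulr_ge0 ?powR_ge0//.
  rewrite ler_pdivlMr// -tau_sum//; apply: lerD => //.
  rewrite ler_wpM2l ?powR_ge0//; apply: le_trans (ler_norm _) _; apply: betaH.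
    by rewrite u0 uT.
  by rewrite lexx T0.
case: (ex_maxnP ex0 ub) => n nT nmax.
pose sigma k := fine (tau k).
have fin k : (k <= n)%N -> (tau k < +oo)%E.
  by move=> kn; apply: le_lt_trans (ltry T); exact: le_trans (tau_homo kn) nT.
have sk k : (k <= n)%N -> tau k = (sigma k)%:E by move=> /fin; exact: tau_fin.
have segE k t : (k <= n)%N -> segment sigma n T k t ->
    (tau k <= t%:E < tau k.+1)%E.
  move=> kn [/andP[kt tT] tk]; rewrite sk// lee_fin kt/=.
  have [kn'|nk] := ltnP k n; first by rewrite sk// lte_fin tk.
  have -> : k = n by apply/eqP; rewrite eqn_leq kn nk.
  apply: (@le_lt_trans _ _ T%:E); first by rewrite lee_fin.
  by rewrite ltNge; apply/negP => /nmax; rewrite ltnn.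
exists n, sigma; split.
- split=> // [k kn|]; last by rewrite -lee_fin -sk.
  by rewrite -lte_fin -!sk//; [exact/tau_lt/fin/ltnW|exact: ltnW].
- by move=> k kn; exact/tau_sum/fin.
- move=> k t kn st; have := theta_lt (segE k t kn st).
  rewrite (theta_formula (segE k t kn st)) /angle -/(sigma k).
  have := tau_sum (fin _ kn); rewrite -/(sigma k) -natr1 mulrDl => <-; lra.
- case: sol => _ rr0 _ rh rt; split.
  + by rewrite -rr0 right_lim_cadlag.
  + by move=> k kn; have := rh k (fin k.+1 kn); rewrite right_lim_cadlag// fine_ge0//; exact: tau_ge0.
  + move=> k t kn st; have [E1 E2] := rt k t (segE k t kn st); split => //.
    by rewrite E1 right_lim_cadlag//; exact: fine_ge0.
Qed.

End PerturbedPath.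
End ImpactTimes.

(** * Piecewise affine time changes *)

Section Retiming.
Context {R : realType}.
Implicit Types (s t u a rho T : R).

Lemma abs_ln_le (q rho : R) : 0 <= rho -> rho <= 2^-1 -> 1 - rho <= q <= 1 + rho ->
  `|ln q| <= 2 * rho.
Proof.
move=> r0 r1 /andP[q1 q2]; have q0 : 0 < q by lra.
have lnle (x : R) : 0 < x -> ln x <= x - 1.
  move=> x0; rewrite -ler_expR lnK ?posrE//.
  by apply: le_trans (expR_ge1Dx _); lra.
rewrite ler_norml; apply/andP; split; last by have := lnle q q0; lra.
have /lnle : 0 < q^-1 by rewrite invr_gt0.
rewrite lnV ?posrE// => h; rewrite lerNl; apply: le_trans h _.
rewrite lerBlDr -(ler_pM2l q0) mulfV ?gt_eqF//; nra.
Qed.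

Lemma cuts_nondecreasing (sigma : nat -> R) n j k :
    (forall i, (i < n)%N -> sigma i < sigma i.+1) -> (j <= k)%N -> (k <= n)%N ->
  sigma j <= sigma k.
Proof.
move=> lt; elim: k => [|k ih]; first by rewrite leqn0 => /eqP ->.
rewrite leq_eqVlt => /predU1P[->//|]; rewrite ltnS => jk kn.
exact: le_trans (ih jk (ltnW kn)) (ltW (lt k kn)).
Qed.

Lemma segment_cover (sigma : nat -> R) n T t : sigma 0%N = 0 -> 0 <= t <= T ->
  exists2 k, (k <= n)%N & segment sigma n T k t.
Proof.
move=> s0 /andP[t0 tT].
have ex : exists k, (k <= n)%N && (sigma k <= t) by exists 0%N; rewrite s0 t0.
have ub k : (k <= n)%N && (sigma k <= t) -> (k <= n)%N by case/andP.
case: (ex_maxnP ex ub) => k /andP[kn kt] kmax.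
exists k => //; split; first by rewrite kt tT.
move=> kn'; rewrite ltNge; apply/negP => h.
by have := kmax k.+1; rewrite kn' h ltnn => /(_ isT).
Qed.

Section AffineTimeChange.
Variables (n : nat) (sigma s : nat -> R) (T rho : R).
Hypotheses (sigma0 : sigma 0%N = 0) (s0 : s 0%N = 0).
Hypotheses (sigmaT : sigma n.+1 = T) (sT : s n.+1 = T).
Hypothesis sigma_lt : forall k, (k <= n)%N -> sigma k < sigma k.+1.
Hypotheses (rho0 : 0 <= rho) (rho1 : rho <= 2^-1).
Hypothesis gap : forall k, (k <= n)%N ->
  `|(s k.+1 - s k) - (sigma k.+1 - sigma k)| <= rho * (sigma k.+1 - sigma k).

Let slope k := (s k.+1 - s k) / (sigma k.+1 - sigma k).
(** The length of the part of the [k]-th piece that precedes [t].  As a sum of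
    clamps, the time change is visibly continuous and inherits the bounds on its
    slopes, without gluing affine pieces. *)
Let clamp k t := Num.min (Num.max t (sigma k)) (sigma k.+1) - sigma k.
Let lam t := \sum_(k < n.+1) slope k * clamp k t.

Let slope_bnd k : (k <= n)%N -> 1 - rho <= slope k <= 1 + rho.
Proof.
move=> kn; have g0 : 0 < sigma k.+1 - sigma k by rewrite subr_gt0 sigma_lt.
rewrite /slope ler_pdivlMr// ler_pdivrMr//.
by have := gap kn; rewrite ler_norml => /andP[h1 h2]; lra.
Qed.

Let sigma_le j k : (j <= k)%N -> (k <= n.+1)%N -> sigma j <= sigma k.
Proof. exact: cuts_nondecreasing. Qed.

Let clampE k t j : (k <= n)%N -> sigma k <= t <= sigma k.+1 -> (j <= n)%N ->
  clamp j t = if (j < k)%N then sigma j.+1 - sigma j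
              else if j == k then t - sigma k else 0.
Proof.
move=> kn /andP[kt tk] jn; rewrite /clamp; case: ltngtP => jk.
- rewrite max_l; last exact: le_trans (sigma_le (ltnW jk) (leqW kn)) kt.
  by rewrite min_r//; exact: le_trans (sigma_le jk (leqW kn)) kt.
- have h : t <= sigma j by exact: le_trans tk (sigma_le jk (leqW jn)).
  by rewrite max_r// min_l ?subrr//; exact/ltW/sigma_lt.
- by rewrite jk max_l// min_l.
Qed.

Let sum_clamp (c : nat -> R) k t : (k <= n)%N -> sigma k <= t <= sigma k.+1 ->
  \sum_(j < n.+1) c j * clamp j t =
  \sum_(j < k) c j * (sigma j.+1 - sigma j) + c k * (t - sigma k).
Proof.
move=> kn kt; rewrite -(big_mkord predT (fun j => c j * clamp j t)).
rewrite (@big_cat_nat _ _ _ k.+1)//=.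
rewrite [X in _ + X]big_nat_cond [X in _ + X]big1 ?addr0; last first.
  move=> j /andP[/andP[kj jn] _]; rewrite (clampE kn kt)//.
  by rewrite ltnNge (ltnW kj)/= gtn_eqF// mulr0.
rewrite big_nat_recr//= (clampE kn kt)// ltnn eqxx; congr (_ + _).
rewrite big_mkord; apply: eq_bigr => j _; rewrite (clampE kn kt) ?ltn_ord//.
exact: leq_trans (ltnW (ltn_ord j)) kn.
Qed.

Let lamE k t : (k <= n)%N -> sigma k <= t <= sigma k.+1 ->
  lam t = s k + slope k * (t - sigma k).
Proof.
move=> kn kt; rewrite /lam (sum_clamp _ kn kt); congr (_ + _).
have -> : s k = \sum_(j < k) (s j.+1 - s j).
  by rewrite -(big_mkord predT (fun j => s j.+1 - s j)) telescope_sumr// s0 subr0.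
apply: eq_bigr => j _; rewrite /slope divfK// gt_eqF// subr_gt0 sigma_lt//.
exact: leq_trans (ltnW (ltn_ord j)) kn.
Qed.

Let cover t : 0 <= t <= T -> exists2 k, (k <= n)%N & sigma k <= t <= sigma k.+1.
Proof.
move=> tT; have [k kn [/andP[kt tT'] tk]] := segment_cover n sigma0 tT.
exists k => //; rewrite kt/=.
have [/tk/ltW//|nk] := ltnP k n.
have -> : k = n by apply/eqP; rewrite eqn_leq kn nk.
by rewrite sigmaT.
Qed.

Let clamp_sum t : 0 <= t <= T -> \sum_(k < n.+1) clamp k t = t.
Proof.
move=> /cover[k kn kt].
have -> : \sum_(j < n.+1) clamp j t = \sum_(j < n.+1) (fun=> 1) j * clamp j t.
  by apply: eq_bigr => j _; rewrite mul1r.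
rewrite (sum_clamp (fun=> 1) kn kt).
rewrite -(big_mkord predT (fun j => 1 * (sigma j.+1 - sigma j))).
rewrite (eq_bigr _ (fun j _ => mul1r (sigma j.+1 - sigma j))) telescope_sumr//.
by rewrite sigma0; lra.
Qed.

Let clamp_homo k : {homo clamp k : u t / u <= t}.
Proof.
move=> u t ut; rewrite /clamp lerD2r le_min ge_min ge_max !le_max ut lexx.
by rewrite !orbT/= ge_min lexx orbT.
Qed.

Let lam_bnd u t : 0 <= u -> u <= t -> t <= T ->
  (1 - rho) * (t - u) <= lam t - lam u <= (1 + rho) * (t - u).
Proof.
move=> u0 ut tT.
have E : t - u = \sum_(k < n.+1) (clamp k t - clamp k u).
  by rewrite sumrB !clamp_sum// ?u0 ?(le_trans u0 ut) ?(le_trans ut tT).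
have -> : lam t - lam u = \sum_(k < n.+1) slope k * (clamp k t - clamp k u).
  by rewrite /lam -sumrB; apply: eq_bigr => k _; rewrite [RHS]mulrBr.
rewrite E !mulr_sumr; apply/andP; split; apply: ler_sum => k _.
  rewrite ler_wpM2r ?subr_ge0 ?clamp_homo//.
  by have /andP[] := slope_bnd (ltnSE (ltn_ord k)).
rewrite ler_wpM2r ?subr_ge0 ?clamp_homo//.
by have /andP[] := slope_bnd (ltnSE (ltn_ord k)).
Qed.

Let T_ge0 : 0 <= T. Proof. by rewrite -sigmaT -sigma0 sigma_le. Qed.

Let lam0 : lam 0 = 0.
Proof.
rewrite (@lamE 0%N)//; first by rewrite sigma0 s0 subrr mulr0 addr0.
by rewrite sigma0 lexx -sigma0 ltW// sigma_lt.
Qed.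

Let lamT : lam T = T.
Proof.
rewrite (@lamE n)//; last by rewrite sigmaT lexx -sigmaT ltW// sigma_lt.
rewrite /slope sigmaT sT divfK; first by lra.
by rewrite gt_eqF// subr_gt0 -sigmaT sigma_lt.
Qed.

Let lam_continuous : continuous lam.
Proof.
have -> : lam = \sum_(k < n.+1) (fun t => slope k * clamp k t).
  by apply/funext => t; rewrite fct_sumE.
apply: (big_ind (fun f : R -> R => continuous f)).
- exact: cst_continuous.
- by move=> f g cf cg x; apply: continuousD; [exact: cf|exact: cg].
- move=> k _ x; apply: cvgM; first exact: cvg_cst.
  apply: cvgB; last exact: cvg_cst.
  have cmax : {for x, continuous (fun t => Num.max t (sigma k))}.
    by apply: (@continuous_max R R id (cst _)); [exact: cvg_id|exact: cvg_cst].
  exact: (@continuous_min R R _ (cst _) x cmax (cvg_cst _)).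
Qed.

Lemma retiming_distortion : (time_distortion T lam <= (2 * rho)%:E)%E.
Proof.
apply: ge_ereal_sup => _ [u [t [u0 ut tT ->]]].
rewrite lee_fin; apply: abs_ln_le => //.
have := lam_bnd u0 (ltW ut) tT.
by rewrite -subr_gt0 in ut; rewrite ler_pdivlMr// ler_pdivrMr.
Qed.

Lemma retiming_time_change : time_changes T lam.
Proof.
have rho2 : 0 < 1 - rho by rewrite subr_gt0 (le_lt_trans rho1)// invf_lt1 ?ltr1n.
have lamlt u t : 0 <= u -> u < t -> t <= T -> lam u < lam t.
  move=> u0 ut tT; have /andP[h _] := lam_bnd u0 (ltW ut) tT.
  have : 0 < (1 - rho) * (t - u) by rewrite mulr_gt0// subr_gt0.
  by rewrite -(subr_gt0 (lam u)); move=> /lt_le_trans; apply.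
have lamle u t : 0 <= u -> u <= t -> t <= T -> lam u <= lam t.
  by move=> u0; rewrite le_eqVlt => /predU1P[->//|ut tT]; exact/ltW/lamlt.
split.
- by move=> u t; rewrite !in_itv/= => /andP[u0 _] /andP[_ tT] ut; exact: lamlt.
- exact: continuous_subspaceT.
- split.
  + move=> t /=; rewrite !in_itv/= => /andP[t0 tT].
    have := lamle 0 t (lexx 0) t0 tT; have := lamle t T t0 tT (lexx T).
    by rewrite lam0 lamT => -> ->.
  + move=> u t; rewrite !inE/= !in_itv/= => /andP[u0 uT] /andP[t0 tT] E.
    have [ut|tu|//] := ltgtP u t.
      by have := lamlt u t u0 ut tT; rewrite E ltxx.
    by have := lamlt t u t0 tu uT; rewrite E ltxx.
  + move=> v /=; rewrite in_itv/= => /andP[v0 vT].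
    have [] := @IVT R lam 0 T v T_ge0 (continuous_subspaceT lam_continuous).
      by rewrite lam0 lamT ge_min le_max v0 vT orbT.
    by move=> c cT <-; exists c.
- exact: le_lt_trans retiming_distortion (ltry _).
Qed.

(** Cuts [sigma k] and [s k] whose gaps have ratios in [1 - rho, 1 + rho] yield a
    competitor in the infimum that defines the Skorohod distance. *)
Lemma skorohod_retiming (x1 x2 : R -> plane) a :
    (forall k t, (k <= n)%N -> segment sigma n T k t ->
      euclidean_norm (x1 t - x2 (s k + (s k.+1 - s k) / (sigma k.+1 - sigma k) *
                                       (t - sigma k))) <= a) ->
  (skorohod T x1 x2 <= (Num.max (2 * rho) a)%:E)%E.
Proof.
move=> H; apply: (@le_trans _ _ (maxe (time_distortion T lam)
   (ereal_sup [set (euclidean_norm (x1 t - x2 (lam t)))%:E | t in `[0, T]]))).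
  by apply: ereal_inf_lbound; exists lam => //; exact: retiming_time_change.
rewrite EFin_max ge_max !le_max retiming_distortion/=; apply/orP; right.
apply: ge_ereal_sup => x [t]; rewrite /= in_itv/= => tT <-; rewrite lee_fin.
have [k kn st] := segment_cover n sigma0 tT.
rewrite (@lamE k)//; first exact: H.
case: st => /andP[kt tT'] tk; rewrite kt/=.
have [/tk/ltW//|nk] := ltnP k n.
have -> : k = n by apply/eqP; rewrite eqn_leq kn nk.
by rewrite sigmaT.
Qed.

End AffineTimeChange.

(** The identity is the affine time change with a single piece. *)
Lemma skorohod_le_uniform T (x1 x2 : R -> plane) a : 0 < T ->
    (forall t, 0 <= t <= T -> euclidean_norm (x1 t - x2 t) <= a) ->
  (skorohod T x1 x2 <= a%:E)%E.
Proof.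
move=> T0 H; have a0 : 0 <= a.
  by apply: le_trans (H 0 _); rewrite ?lexx ?(ltW T0)// sqrtr_ge0.
pose sg (k : nat) := if k is 0%N then 0 else T.
have := @skorohod_retiming 0 sg sg T 0 erefl erefl erefl erefl.
move=> /(_ _ (lexx _) _ _ x1 x2 a); rewrite mulr0 max_r//; apply.
- by case.
- by rewrite invr_ge0.
- by move=> k _; rewrite subrr normr0 mul0r.
- move=> [|//] t _ [/=]; rewrite subr0 divff ?gt_eqF// mul1r add0r => tT _.
  by rewrite subr0; exact: H.
Qed.

End Retiming.

(** * Separation of the noise level from the Hoelder constant *)

Ltac nneg := repeat first
  [ assumption | apply: ltW; assumption | apply: addr_ge0 | apply: mulr_ge0 | exact: sqr_ge0
  | exact: powR_ge0 | exact: expR_ge0 | exact: ler0n | exact: ler01 ].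

Section Numerics.
Context {R : realType}.

Lemma powR_le1D (u g : R) : 0 <= u -> 0 < g -> g <= 1 -> u `^ g <= 1 + u.
Proof.
move=> u0 g0 g1; have [u1|/ltW u1] := leP u 1.
  apply: (@le_trans _ _ 1); last by rewrite lerDl.
  have : u `^ g <= 1 `^ g by apply: ge0_ler_powR; rewrite ?nnegrE ?(ltW g0).
  by rewrite powR1.
by apply: le_trans (ler1_powR u1 g1) _; rewrite lerDr.
Qed.

Variables (eps K p gamma tau M F G T : R).
Hypotheses (eps0 : 0 < eps) (K0 : 0 <= K) (gamma0 : 0 < gamma) (gamma1 : gamma <= 1).
Hypotheses (tau0 : 0 <= tau) (M0 : 0 <= M) (F0 : 0 <= F) (G0 : 0 <= G) (T0 : 0 <= T).

(** The three powers come from the displaced impact times, from the second order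
    of the Taylor expansions, and from the noise read at times [eps^p] apart. *)
Definition error_rate (eps p gamma : R) : R := eps `^ p + eps ^+ 2 + eps `^ (1 + p * gamma).

Lemma error_rate_ge :
  [/\ eps `^ p <= error_rate eps p gamma, eps ^+ 2 <= error_rate eps p gamma,
      eps `^ (1 + p * gamma) <= error_rate eps p gamma & 0 <= error_rate eps p gamma].
Proof.
rewrite /error_rate; have := powR_ge0 eps p; have := powR_ge0 eps (1 + p * gamma).
have := sqr_ge0 eps.
move: (eps `^ p) (eps `^ (1 + p * gamma)) (eps ^+ 2) => x y z x0 y0 z0.
by split; lra.
Qed.

Definition fine_constant (tau M F P G T : R) : R :=
  8 * (tau * G) +
  P * ((1 + 3 * tau) + M * (F * tau) ^+ 2 + 4 * (tau * G) * (M * (1 + F * tau))) +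
  (4 * (tau * G) * T + tau).

Lemma fine_constant_ge0 P : 0 <= P -> 0 <= fine_constant tau M F P G T.
Proof. by move=> P0; rewrite /fine_constant; nneg. Qed.

(** The left-hand side is polynomial in [K]: [K^gamma] is at most [1 + K], and
    [(1 + K)^2] is at most [expR (2 K)]. *)
Lemma fine_estimate (P del S : R) : 0 <= P ->
    del = eps `^ p * (K * tau) -> S = F * (K * tau) ->
  Num.max (2 * (4 * del * G))
    (P * (eps * (K * (3 * del) `^ gamma) + M * (eps * S) ^+ 2 + 4 * del * G * (M * (1 + S)))
     + (4 * del * G * T + del)) <=
  fine_constant tau M F P G T * error_rate eps p gamma * expR (2 * K).
Proof.
move=> P0 dE SE; have [epe e2e ege e0] := error_rate_ge.
have YY : expR (2 * K) = expR K * expR K by rewrite -expRD; congr expR; lra.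
have Y1K : 1 + K <= expR K by exact: expR_ge1Dx.
have t1' : eps * (K * (3 * del) `^ gamma) =
    eps `^ (1 + p * gamma) * (K * (3 * (K * tau)) `^ gamma).
  have -> : 3 * del = eps `^ p * (3 * (K * tau)) by rewrite dE; lra.
  rewrite powRM; [|nneg|nneg]; rewrite -powRrM.
  rewrite [eps `^ (1 + _)]powRD; last by apply/implyP => _; rewrite gt_eqF.
  rewrite (powRr1 (ltW eps0)); lra.
rewrite t1' YY; move: epe e2e ege e0 Y1K.
move: (error_rate eps p gamma) (expR K) => e Y epe e2e ege e0 Y1K.
have Y1 : 1 <= Y by apply: le_trans Y1K; rewrite lerDl.
have KY : K <= Y by apply: le_trans Y1K; rewrite lerDr.
have Y0 : 0 <= Y by exact: le_trans Y1.
have HY : K * tau <= tau * Y by rewrite mulrC ler_wpM2l.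
have H0 : 0 <= K * tau by nneg.
have del0 : 0 <= del by rewrite dE; nneg.
have YYY : e * Y <= e * (Y * Y) by rewrite ler_wpM2l// ler_peMr.
have delY : del <= tau * (e * Y).
  have -> : tau * (e * Y) = e * (tau * Y) by lra.
  by rewrite dE ler_pM// powR_ge0.
have SY : S <= F * tau * Y by rewrite SE -mulrA ler_wpM2l.
have S0 : 0 <= S by rewrite SE; nneg.
have E0 : 0 <= e * (Y * Y) by nneg.
have t1 : eps `^ (1 + p * gamma) * (K * (3 * (K * tau)) `^ gamma) <= (1 + 3 * tau) * (e * (Y * Y)).
  have -> : (1 + 3 * tau) * (e * (Y * Y)) = e * (Y * ((1 + 3 * tau) * Y)) by lra.
  apply: ler_pM; [nneg|nneg|done|apply: ler_pM; [done|nneg|done|]].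
  apply: le_trans (powR_le1D _ gamma0 gamma1) _; first by nneg.
  lra.
have t2 : M * (eps * S) ^+ 2 <= M * (F * tau) ^+ 2 * (e * (Y * Y)).
  have -> : M * (F * tau) ^+ 2 * (e * (Y * Y)) = M * (e * (F * tau * Y) ^+ 2) by lra.
  rewrite ler_wpM2l// exprMn; apply: ler_pM; [nneg|nneg|done|].
  by rewrite ler_sqr ?nnegrE//; nneg.
have t3 : 4 * del * G * (M * (1 + S)) <= 4 * (tau * G) * (M * (1 + F * tau)) * (e * (Y * Y)).
  have -> : 4 * (tau * G) * (M * (1 + F * tau)) * (e * (Y * Y)) =
    (4 * (tau * (e * Y)) * G) * (M * ((1 + F * tau) * Y)) by lra.
  apply: ler_pM; [nneg|nneg| |].
    by rewrite ler_wpM2r// ler_wpM2l.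
  by rewrite ler_wpM2l// mulrDl mul1r lerD.
have kapY := lerD (lerD t1 t2) t3.
rewrite -!mulrDl in kapY; have {}kapY := ler_wpM2l P0 kapY; rewrite [leRHS]mulrA in kapY.
have delYY : del <= tau * (e * (Y * Y)).
  by apply: le_trans delY _; rewrite ler_wpM2l.
have rhoYY : 4 * del * G <= 4 * (tau * G) * (e * (Y * Y)).
  have -> : 4 * (tau * G) * (e * (Y * Y)) = 4 * (tau * (e * (Y * Y))) * G by lra.
  by rewrite ler_wpM2r// ler_wpM2l.
have rhoT := ler_wpM2r T0 rhoYY.
have delR : 4 * del * G * T + del <= (4 * (tau * G) * T + tau) * (e * (Y * Y)) by lra.
rewrite /fine_constant -[leRHS]mulrA; move: kapY delR rhoYY E0; move: (e * (Y * Y)) => E.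
move=> kapY delR rhoYY E0; rewrite ge_max; apply/andP; split.
  rewrite -[X in X * E]addrA [leRHS]mulrDl -[leLHS]addr0; apply: lerD; first by lra.
  by nneg.
rewrite -[X in X * E]addrA [leRHS]mulrDl -[leLHS]add0r; apply: lerD; first by nneg.
by rewrite [leRHS]mulrDl; apply: lerD.
Qed.

Variables (A lnB alpha r0 Mr : R).
Hypotheses (A0 : 0 <= A) (lnB0 : 0 <= lnB) (alpha0 : 0 < alpha) (r00 : 0 <= r0) (Mr0 : 0 <= Mr).

Definition crude_constant (tau M F G T A lnB alpha r0 Mr : R) : R :=
  (2 * A * expR (lnB * (T / alpha)) * (M + r0 + tau) + (Mr + F * tau) + (2 * T + tau)) *
  (8 * (tau * G)).

Lemma crude_constant_ge0 : 0 <= crude_constant tau M F G T A lnB alpha r0 Mr.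
Proof. by rewrite /crude_constant; nneg. Qed.

(** The hypothesis [1 <= 8 del G] contributes the factor [eps^p], at the cost of
    one more power of [K]. *)
Lemma crude_estimate :
  let del := eps `^ p * (K * tau) in
  1 <= 8 * del * G ->
  2 * A * expR (lnB * ((T + K * tau) / alpha)) * (M + r0 + K * tau) + (Mr + F * (K * tau)) +
    (T + K * tau + T) <=
  crude_constant tau M F G T A lnB alpha r0 Mr * error_rate eps p gamma *
    expR ((2 + lnB * (tau / alpha)) * K) :> R.
Proof.
move=> del big; have [epe _ _ e0] := error_rate_ge.
have YYZ : expR ((2 + lnB * (tau / alpha)) * K) =
    expR K * expR K * expR (lnB * (tau / alpha) * K).
  by rewrite -!expRD; congr expR; lra.
have EZ : expR (lnB * ((T + K * tau) / alpha)) =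
    expR (lnB * (T / alpha)) * expR (lnB * (tau / alpha) * K).
  by rewrite -expRD; congr expR; lra.
have Z1 : 1 <= expR (lnB * (tau / alpha) * K).
  rewrite -[leLHS](expR0 R) ler_expR; apply: mulr_ge0 => //; apply: mulr_ge0 => //.
  by apply: divr_ge0 => //; exact: ltW.
have Y1K : 1 + K <= expR K by exact: expR_ge1Dx.
have Q0 : 0 <= expR (lnB * (T / alpha)) by exact: expR_ge0.
rewrite /crude_constant YYZ EZ; move: epe e0 Y1K Q0 Z1.
move: (error_rate eps p gamma) (expR K) (expR (lnB * (T / alpha)))
  (expR (lnB * (tau / alpha) * K)) => e Y Q Z epe e0 Y1K Q0 Z1.
have Y1 : 1 <= Y by apply: le_trans Y1K; rewrite lerDl.
have KY : K <= Y by apply: le_trans Y1K; rewrite lerDr.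
have Y0 : 0 <= Y by exact: le_trans Y1.
have Z0 : 0 <= Z by exact: le_trans Z1.
have HY : K * tau <= tau * Y by rewrite mulrC ler_wpM2l.
have H0 : 0 <= K * tau by nneg.
have YZ1 : Y <= Y * Z by rewrite ler_peMr.
have YZ2 : 1 <= Y * Z by rewrite (le_trans Y1).
have u1 : 2 * A * (Q * Z) * (M + r0 + K * tau) <= 2 * A * Q * (M + r0 + tau) * (Y * Z).
  have h1 : M + r0 + K * tau <= (M + r0 + tau) * Y.
    have : (M + r0) * 1 <= (M + r0) * Y by rewrite ler_wpM2l//; nneg.
    lra.
  have h2 : 0 <= 2 * A * (Q * Z) by nneg.
  by have := ler_wpM2l h2 h1; lra.
have u2 : Mr + F * (K * tau) <= (Mr + F * tau) * (Y * Z).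
  have : Mr * 1 <= Mr * (Y * Z) by rewrite ler_wpM2l.
  have : F * (K * tau) <= F * (tau * (Y * Z)).
    by rewrite ler_wpM2l// (le_trans HY)// ler_wpM2l.
  lra.
have u3 : T + K * tau + T <= (2 * T + tau) * (Y * Z).
  have : T * 1 <= T * (Y * Z) by rewrite ler_wpM2l.
  have : K * tau <= tau * (Y * Z) by rewrite (le_trans HY)// ler_wpM2l.
  lra.
apply: le_trans (lerD (lerD u1 u2) u3) _; rewrite -!mulrDl.
have one : 1 <= 8 * (tau * G) * (e * Y).
  apply: le_trans big _.
  have -> : 8 * (tau * G) * (e * Y) = 8 * (e * (tau * Y)) * G by lra.
  rewrite ler_wpM2r// ler_wpM2l// /del; apply: ler_pM => //; exact: powR_ge0.
have C0 : 0 <= 2 * A * Q * (M + r0 + tau) + (Mr + F * tau) + (2 * T + tau) by nneg.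
move: C0; move: (2 * A * Q * (M + r0 + tau) + (Mr + F * tau) + (2 * T + tau)) => C C0.
have CYZ : 0 <= C * (Y * Z) by nneg.
by have := ler_wpM2l CYZ one; lra.
Qed.

End Numerics.

(** * Comparison with the linearized path on one realization *)

Section DrivenPaths.
Context {R : realType}.
Implicit Types (y g w f : R -> R) (s t : R).

Lemma cadlag_comp f y : continuous f -> cadlag y -> cadlag (f \o y).
Proof.
move=> cf [yr yl]; split=> t t0.
  exact: (cvg_comp y f (yr t t0) (cf (y t))).
have := yl t t0 => /cvg_ex[l yL]; apply/cvg_ex; exists (f l).
exact: (cvg_comp y f yL (cf l)).
Qed.

Lemma cadlag_mul y g : cadlag y -> cadlag g -> cadlag (fun t => y t * g t).
Proof.
move=> [yr yl] [gr gl]; split=> t t0; first by apply: cvgM; [exact: yr|exact: gr].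
have := yl t t0 => /cvg_ex[l yL]; have := gl t t0 => /cvg_ex[m gL].
by apply/cvg_ex; exists (l * m); exact: cvgM.
Qed.

(** Common form of the three equations, with [c = 0] for the deterministic
    radius, [c = eps] for the perturbed one and [c = 1] for the fluctuation; the
    resets only appear in the values [y (sigma k)]. *)
Definition driven_on (sigma : nat -> R) (n : nat) (T : R) g w (c : R) y : Prop :=
  forall k t, (k <= n)%N -> segment sigma n T k t ->
    y t = y (sigma k) + \int[lebesgue_measure]_(x in `[sigma k, t]) g x
          + c * (w t - w (sigma k)).

Lemma segmentW sigma n T k t s :
  segment sigma n T k t -> sigma k <= s <= t -> segment sigma n T k s.
Proof.
move=> [/andP[kt tT] tk] /andP[ks st]; split; first by rewrite ks (le_trans st).
by move=> /tk; exact: le_lt_trans.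
Qed.

Lemma driven_segment sigma n T g w (c : R) y k t :
    0 <= sigma k -> (k <= n)%N -> segment sigma n T k t ->
    cadlag g -> {within `[0, +oo[, continuous w} ->
    driven_on sigma n T g w c y ->
  [/\ {within `[sigma k, t], continuous (fun s => y s - c * w s)},
      {within `[sigma k, t], continuous y} &
      forall s, sigma k < s < t -> {for s, continuous g} ->
        is_derive s 1 (fun s => y s - c * w s) (g s)].
Proof.
move=> k0 kn st cg cw dy.
have H s : sigma k <= s <= t -> y s = y (sigma k) +
    \int[lebesgue_measure]_(x in `[sigma k, s]) g x + c * (w s - w (sigma k)).
  by move=> ks; apply: dy => //; exact: segmentW ks.
have := st => -[/andP[kt _] _]; move: kt; rewrite le_eqVlt => /predU1P[kt|kt].
  rewrite -kt set_itv1; split; [exact: continuous_subspace1..|].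
  by move=> s /andP[ks sk]; move: (lt_trans ks sk); rewrite ltxx.
have [c1 c2] := driven_path_continuous k0 kt cg cw H.
split => // s ks cgs; exact: (driven_path_derive k0 ks cg cgs H).
Qed.

Lemma within_continuous_interior f (u v s : R) :
  {within `[u, v], continuous f} -> u < s < v -> {for s, continuous f}.
Proof.
move=> cf usv; have uv : u < v by case/andP: usv; exact: lt_trans.
by apply: (within_continuous_continuous uv cf); rewrite in_itv.
Qed.

Lemma affine_at_right f (u u' m l : R) : 0 < m ->
  f x @[x --> u'^'+] --> l -> f (u' + m * (x - u)) @[x --> u^'+] --> l.
Proof.
move=> m0 fl; pose F x := u' + m * (x - u).
have Fu : F u = u' by rewrite /F subrr mulr0 addr0.
apply: (@increasing_cvg_at_right_comp R F f u +oo%O l) => //.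
- by move=> x y _ _ xy; rewrite /F ltrD2l ltr_pM2l// ltrD2r.
- apply: cvg_at_right_filter; apply: cvgD; first exact: cvg_cst.
  by apply: cvgM; [exact: cvg_cst|apply: cvgB; [exact: cvg_id|exact: cvg_cst]].
- by rewrite Fu.
Qed.

Lemma affine_at_left f (u u' v m l : R) : 0 < m ->
  f x @[x --> (u' + m * (v - u))^'-] --> l ->
  f (u' + m * (x - u)) @[x --> v^'-] --> l.
Proof.
move=> m0 fl; pose F x := u' + m * (x - u).
apply: (@increasing_cvg_at_left_comp R F f -oo%O v l) => //.
- by move=> x y _ _ xy; rewrite /F ltrD2l ltr_pM2l// ltrD2r.
- apply: cvg_at_left_filter; apply: cvgD; first exact: cvg_cst.
  by apply: cvgM; [exact: cvg_cst|apply: cvgB; [exact: cvg_id|exact: cvg_cst]].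
Qed.

Lemma within_continuous_affine f (u v u' m : R) : 0 < m -> u <= v ->
    {within `[u', u' + m * (v - u)], continuous f} ->
  {within `[u, v], continuous (fun x => f (u' + m * (x - u)))}.
Proof.
move=> m0; rewrite le_eqVlt => /predU1P[<- _|uv cf].
  by rewrite set_itv1; exact: continuous_subspace1.
have uv' : u' < u' + m * (v - u) by rewrite ltrDl mulr_gt0// subr_gt0.
have /(continuous_within_itvP _ uv')[c1 c2 c3] := cf.
apply/(continuous_within_itvP _ uv); split.
- move=> x; rewrite in_itv/= => /andP[ux xv].
  apply: (@continuous_comp _ _ _ (fun x => u' + m * (x - u)) f).
    apply: cvgD; first exact: cvg_cst.
    by apply: cvgM; [exact: cvg_cst|apply: cvgB; [exact: cvg_id|exact: cvg_cst]].
  apply: c1; rewrite in_itv/= ltrDl mulr_gt0 ?subr_gt0//=.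
  by rewrite ltrD2l ltr_pM2l// ltrD2r.
- rewrite subrr mulr0 addr0; exact: affine_at_right.
- exact: affine_at_left.
Qed.

Lemma is_derive_affine f (u u' m x df : R) : is_derive (u' + m * (x - u)) 1 f df ->
  is_derive x 1 (fun x => f (u' + m * (x - u))) (m * df).
Proof.
move=> fd; rewrite mulrC.
have h : is_derive x 1 (fun x => u' + m * (x - u)) m.
  have h1 : is_derive x 1 (fun x : R => x - u) 1.
    by apply: (is_derive_eq (is_deriveB (is_derive_id x (1 : R)) (is_derive_cst u x (1 : R)))); rewrite subr0.
  apply: (is_derive_eq (is_deriveD (is_derive_cst u' x (1 : R)) (is_deriveZ m h1))).
  by rewrite add0r /GRing.scale/= mulr1.
exact: (@is_derive1_comp R f (fun x => u' + m * (x - u)) x df m fd h).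
Qed.

End DrivenPaths.

Section Pathwise.
Context {R : realType}.
Variables (b h : R -> R) (M alpha r0 T : R) (N : nat) (r theta : R -> R).
Hypotheses (db : forall x : R, derivable b x 1) (ddb : forall x : R, derivable (derive1 b) x 1).
Hypotheses (dh : forall x : R, derivable h x 1) (ddh : forall x : R, derivable (derive1 h) x 1).
Hypotheses (bM : forall x, `|b x| <= M) (b1M : forall x, `|derive1 b x| <= M)
  (b2M : forall x, `|derive1 (derive1 b) x| <= M).
Hypotheses (h1M : forall x, `|derive1 h x| <= M)
  (h2M : forall x, `|derive1 (derive1 h) x| <= M) (h0 : h 0 = 0).
Hypotheses (alpha0 : 0 < alpha) (NT : N%:R * alpha < T) (TN : T < N.+1%:R * alpha).
Hypothesis det : deterministic_solution b h alpha r0 r theta.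

Let grid (k : nat) : R := k%:R * alpha.
Let M0 : 0 <= M. Proof. exact: le_trans (bM 0). Qed.
Let grid_ge0 k : 0 <= grid k. Proof. by rewrite mulr_ge0// ltW. Qed.
Let T0 : 0 < T. Proof. exact: le_lt_trans (grid_ge0 N) NT. Qed.
Let gridS k : grid k.+1 = grid k + alpha. Proof. by rewrite /grid -natr1 mulrDl mul1r. Qed.
Let cr : cadlag r. Proof. by case: det => [[]]. Qed.

Let derivable_cont (f : R -> R) : (forall x : R, derivable f x 1) -> continuous f.
Proof. by move=> df x; apply: differentiable_continuous; exact/derivable1_diffP. Qed.

Let grid_segment k t : (k <= N)%N -> segment grid N T k t ->
  grid k <= t < grid k.+1.
Proof.
move=> kN [/andP[kt tT] tk]; rewrite kt/=.
have [/tk//|Nk] := ltnP k N.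
have -> : k = N by apply/eqP; rewrite eqn_leq kN Nk.
exact: le_lt_trans tT TN.
Qed.

Let det_segment k t : (k <= N)%N -> segment grid N T k t ->
  r t = r (grid k) + \int[lebesgue_measure]_(s in `[grid k, t]) b (r s) /\
  theta t = t - grid k.
Proof.
move=> kN st; case: det => _ _ _ /(_ k t (grid_segment kN st)).
by rewrite (right_lim_cadlag cr (grid_ge0 k)).
Qed.

Let r_driven : driven_on grid N T (b \o r) (cst 0) 0 r.
Proof. by move=> k t kN st; have [-> _] := det_segment kN st; rewrite mul0r addr0. Qed.

Let cst0_cont : {within `[0, +oo[, continuous (cst 0 : R -> R)}.
Proof. by move=> x; exact: cst_continuous. Qed.

Let cbr : cadlag (b \o r). Proof. exact/cadlag_comp/cr/derivable_cont. Qed.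

Let r_segment k t : (k <= N)%N -> segment grid N T k t ->
  {within `[grid k, t], continuous r} /\
  forall s, grid k < s < t -> is_derive s 1 r (b (r s)).
Proof.
move=> kN st.
have [_ c2 c3] := driven_segment (grid_ge0 k) kN st cbr cst0_cont r_driven.
split => // s ks; have rs := within_continuous_interior c2 ks.
have := c3 s ks (continuous_comp rs (derivable_cont db (x := r s))).
by congr is_derive; apply/funext => x /=; rewrite mul0r subr0.
Qed.

Let r_jump k : r (grid k.+1) = h (left_lim r (grid k.+1)).
Proof. by case: det => _ _ <- _; rewrite (right_lim_cadlag cr (grid_ge0 k.+1)). Qed.

Section Fluctuation.
Variables (w r1 : R -> R) (H : R).
Hypothesis cw : {within `[0, +oo[, continuous w}.
Hypothesis wH : forall s t, 0 <= s <= T -> 0 <= t <= T -> `|w s - w t| <= H.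
Hypothesis fl : fluctuation_solution b h alpha r w r1.

Let H0 : 0 <= H.
Proof.
have t0 : 0 <= (0 : R) <= T by rewrite lexx ltW.
exact: le_trans (wH t0 t0).
Qed.

Let cr1 : cadlag r1. Proof. by case: fl. Qed.

Let cg : cadlag (fun s => derive1 b (r s) * r1 s).
Proof.
have c1 : cadlag (derive1 b \o r) := cadlag_comp (derivable_cont ddb) cr.
exact: (cadlag_mul c1 cr1).
Qed.

Let r1_driven : driven_on grid N T (fun s => derive1 b (r s) * r1 s) w 1 r1.
Proof.
move=> k t kN st; case: fl => _ _ _ /(_ k t (grid_segment kN st)) ->.
by rewrite (right_lim_cadlag cr1 (grid_ge0 k)) mul1r.
Qed.

Lemma fluctuation_segment k t : (k <= N)%N -> segment grid N T k t ->
  [/\ {within `[grid k, t], continuous r1},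
      {within `[grid k, t], continuous (fun s => r1 s - w s)} &
  forall s, grid k < s < t ->
    is_derive s 1 (fun s => r1 s - w s) (derive1 b (r s) * r1 s)].
Proof.
move=> kN st.
have [c1 c2 c3] := driven_segment (grid_ge0 k) kN st cg cw r1_driven.
have E : (fun s => r1 s - 1 * w s) = (fun s => r1 s - w s).
  by apply/funext => x; rewrite mul1r.
rewrite E in c1 c3; split => // s ks.
have rs := within_continuous_interior (r_segment kN st).1 ks.
have r1s := within_continuous_interior c2 ks.
apply: c3 => //; apply: cvgM r1s.
exact: (continuous_comp rs (derivable_cont ddb (x := r s))).
Qed.

Definition fluctuation_factor : R :=
  2 * gronwall_factor M alpha * (M * gronwall_factor M alpha + 2) ^+ N.

(** The fluctuation equation is linear with bounded coefficients and bounded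
    jump multipliers. *)
Lemma fluctuation_bound t : 0 <= t <= T -> `|r1 t| <= fluctuation_factor * H.
Proof.
move=> tT; have g0 : grid 0%N = 0 by rewrite /grid mul0r.
have [k kN st] := segment_cover N g0 tT.
have := @jump_gronwall R grid N (fun=> r1) T M M H alpha M0 M0 H0.
move=> /(_ _ _ _ _ k t kN st) J; apply: (le_trans (J _ _ _ _)).
- move=> j t' jN /(grid_segment jN) /andP[_]; rewrite gridS => /ltW.
  by rewrite lerBlDl.
- by case: fl => _ E _ _; rewrite g0 -(right_lim_cadlag cr1 (lexx 0)) E normr0.
- move=> j a jN ja; have -> : r1 (grid j.+1) =
      derive1 h (left_lim r (grid j.+1)) * left_lim r1 (grid j.+1).
    by case: fl => _ _ <- _; rewrite (right_lim_cadlag cr1 (grid_ge0 j.+1)).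
  rewrite normrM (le_trans (ler_pM _ _ (h1M _) (_ : _ <= a)))// ?lerDl//.
  apply: (left_lim_norm_le cr1 (grid_ge0 j)); first by rewrite gridS ltrDl.
  move=> s /andP[js sj]; apply: ja; split; last by [].
  rewrite js/= (le_trans (ltW sj))// (le_trans _ (ltW NT))//.
  by rewrite /grid ler_pM2r// ler_nat.
- move=> j t' jN jt.
  have kt' : grid j <= t' <= T by case: jt.
  have [c1 c2 c3] := fluctuation_segment jN jt.
  exists (fun s => r1 s - (w s - w 0)), (fun s => derive1 b (r s) * r1 s); split.
  + have -> : (fun s => r1 s - (w s - w 0)) = (fun s => (r1 s - w s) + cst (w 0) s).
      by apply/funext => s /=; lra.
    by apply: within_continuousD c2 _ => x; exact: cst_continuous.
  + move=> s /andP[ks st']; rewrite opprB addrCA subrr addr0; apply: wH.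
      by rewrite (le_trans _ ks)// (le_trans st')//; case/andP: kt'.
    by rewrite lexx ltW.
  + move=> s /c3 h'; have -> : (fun s => r1 s - (w s - w 0)) = (fun s => (r1 s - w s) + cst (w 0) s).
      by apply/funext => x /=; lra.
    apply: (is_derive_eq (is_deriveD h' (is_derive_cst (w 0) s (1 : R)))).
    by rewrite addr0.
  + by move=> s _; rewrite normrM (le_trans (ler_wpM2r _ (b1M _)))// lerDl.
rewrite /fluctuation_factor ler_wpM2r//.
have := gronwall_factor_ge0 alpha M0; move: (gronwall_factor M alpha) => A A0.
rewrite ler_wpM2l ?mulr_ge0// ler_weXn2l//.
by apply: (@le_trans _ _ 2); rewrite ?ler1n// lerDr mulr_ge0.
Qed.

End Fluctuation.

Section Perturbed.
Variables (w rad : R -> R) (eps H : R) (n : nat) (sigma : nat -> R).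
Hypotheses (eps0 : 0 <= eps) (eps1 : eps <= 1) (r00 : 0 <= r0).
Hypothesis cw : {within `[0, +oo[, continuous w}.
Hypothesis wH : forall s t, 0 <= s <= T -> 0 <= t <= T -> `|w s - w t| <= H.
Hypotheses (sigma0 : sigma 0%N = 0) (sigmaT : sigma n <= T).
Hypothesis sigma_lt : forall k, (k < n)%N -> sigma k < sigma k.+1.
Hypotheses (crad : cadlag rad) (rad0 : rad 0 = r0).
Hypothesis rad_jump : forall k, (k < n)%N ->
  rad (sigma k.+1) = h (left_lim rad (sigma k.+1)).
Hypothesis rad_driven : driven_on sigma n T (b \o rad) w eps rad.

Let H0 : 0 <= H.
Proof.
have t0 : 0 <= (0 : R) <= T by rewrite lexx ltW.
exact: le_trans (wH t0 t0).
Qed.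

Let sigma_ge0 k : (k <= n)%N -> 0 <= sigma k.
Proof. by move=> kn; rewrite -sigma0; exact: cuts_nondecreasing kn. Qed.

Let sigma_leT k : (k <= n)%N -> sigma k <= T.
Proof. by move=> kn; apply: le_trans sigmaT; exact: (cuts_nondecreasing sigma_lt kn (leqnn n)). Qed.

Let rad_segment k t : (k <= n)%N -> segment sigma n T k t ->
  [/\ {within `[sigma k, t], continuous rad},
      {within `[sigma k, t], continuous (fun s => rad s - eps * w s)} &
  forall s, sigma k < s < t ->
    is_derive s 1 (fun s => rad s - eps * w s) (b (rad s))].
Proof.
move=> kn st; have cbrad : cadlag (b \o rad) := cadlag_comp (derivable_cont db) crad.
have [c1 c2 c3] := driven_segment (sigma_ge0 kn) kn st cbrad cw rad_driven.
split => // s ks; apply: c3 => //.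
have rs := within_continuous_interior c2 ks.
exact: (continuous_comp rs (derivable_cont db (x := rad s))).
Qed.

(** The drift is bounded, so the growth rate between impacts is 0, but each reset
    may multiply the radius by [M].  The number [k] of impacts stays explicit
    because it depends on the realization. *)
Lemma perturbed_radius_bound k t : (k <= n)%N -> segment sigma n T k t ->
  `|rad t| <= 2 * gronwall_factor 0 T * (M * gronwall_factor 0 T + 2) ^+ k * (M + r0 + H).
Proof.
have kap0 : 0 <= M + r0 + H by rewrite !addr_ge0.
apply: (@jump_gronwall R sigma n (fun=> rad) T 0 M (M + r0 + H) T (lexx 0) M0 kap0).
- move=> j s jn [/andP[js sT] _].
  by rewrite lerBlDr (le_trans sT)// lerDl sigma_ge0.
- by rewrite sigma0 rad0 ger0_norm// addrAC lerDr addr_ge0.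
- move=> j a jn ja; rewrite rad_jump//.
  have := derive_bounded_lipschitz (left_lim rad (sigma j.+1)) 0 dh h1M.
  rewrite h0 !subr0 => hl; apply: (le_trans hl); rewrite -[leLHS]addr0 lerD// ler_wpM2l//.
  apply: (left_lim_norm_le crad (sigma_ge0 (ltnW jn)) (sigma_lt jn)).
  move=> s /andP[js sj]; apply: ja; split; last by [].
  by rewrite js/= (le_trans (ltW sj))// sigma_leT.
- move=> j t' jn jt; have [c1 c2 c3] := rad_segment jn jt.
  have jt' : sigma j <= t' <= T by case: jt.
  have E : (fun s => rad s - eps * (w s - w 0)) = (fun s => (rad s - eps * w s) + cst (eps * w 0) s).
    by apply/funext => s /=; lra.
  exists (fun s => rad s - eps * (w s - w 0)), (fun s => b (rad s)); split.
  + by rewrite E; apply: within_continuousD c2 _ => x; exact: cst_continuous.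
  + move=> s /andP[ks st']; rewrite opprB addrCA subrr addr0 normrM ger0_norm//.
    apply: (@le_trans _ _ H); last by rewrite lerDr addr_ge0.
    rewrite -[leRHS]mul1r ler_pM//; apply: wH; last by rewrite lexx ltW.
    by rewrite (le_trans _ ks) ?sigma_ge0// (le_trans st')//; case/andP: jt'.
  + move=> s /c3 h'; rewrite E.
    apply: (is_derive_eq (is_deriveD h' (is_derive_cst (eps * w 0) s (1 : R)))).
    by rewrite addr0.
  + by move=> s _; rewrite mul0r add0r (le_trans (bM _))// -addrA lerDl addr_ge0.
Qed.

Section Comparison.
Variables (r1 : R -> R) (m : nat -> R) (rho om S : R).
Hypothesis nN : n = N.
Hypothesis fl : fluctuation_solution b h alpha r w r1.
Hypothesis r1S : forall t, 0 <= t <= T -> `|r1 t| <= S.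
Hypotheses (m0 : forall k, 0 < m k) (mrho : forall k, (k <= n)%N -> `|m k - 1| <= rho).
Let lam k s := grid k + m k * (s - sigma k).
Hypothesis lam_segment : forall k s, (k <= n)%N -> segment sigma n T k s ->
  segment grid n T k (lam k s).
Hypothesis lam_end : forall k, (k < n)%N -> lam k (sigma k.+1) = grid k.+1.
Hypothesis wom : forall k s, (k <= n)%N -> segment sigma n T k s -> `|w s - w (lam k s)| <= om.

Let kap := eps * om + M * (eps * S) ^+ 2 + rho * (M * (1 + S)).

Let z0 : 0 <= (0 : R) <= T. Proof. by rewrite lexx ltW. Qed.
Let S0 : 0 <= S. Proof. exact: le_trans (r1S z0). Qed.
Let rho0 : 0 <= rho. Proof. exact: le_trans (mrho (leq0n n)). Qed.
Let segment0 k : (k <= n)%N -> segment sigma n T k (sigma k).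
Proof. by move=> kn; split; [rewrite lexx sigma_leT|exact: sigma_lt]. Qed.
Let om0 : 0 <= om. Proof. exact: le_trans (wom (leq0n n) (segment0 (leq0n n))). Qed.
Let eom0 : 0 <= eps * om. Proof. exact: mulr_ge0. Qed.
Let q0 : 0 <= M * (eps * S) ^+ 2. Proof. by rewrite mulr_ge0// sqr_ge0. Qed.
Let rm0 : 0 <= rho * (M * (1 + S)).
Proof. by rewrite mulr_ge0// mulr_ge0// addr_ge0. Qed.
Let kap0 : 0 <= kap. Proof. by rewrite !addr_ge0. Qed.
Let kap_om : eps * om <= kap. Proof. by rewrite /kap -addrA lerDl addr_ge0. Qed.
Let kap_sq : M * (eps * S) ^+ 2 <= kap.
Proof. by rewrite /kap addrAC lerDr addr_ge0. Qed.
Let kap_rest : M * (eps * S) ^+ 2 + rho * (M * (1 + S)) <= kap.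
Proof. by rewrite /kap -addrA lerDr. Qed.
Let cr1 : cadlag r1. Proof. by case: fl. Qed.

(** The noise is subtracted from both paths; what is left of it is the difference
    of [w] at the two matched times, at most [om].  Along a piece the drifts
    differ by a Taylor remainder of [b] and by the slope defect [m k - 1].  At an
    impact only a Taylor remainder of [h] appears, since the fluctuation jumps by
    the linearized reset. *)
Lemma comparison_bound k s : (k <= n)%N -> segment sigma n T k s ->
  `|rad s - (r (lam k s) + eps * r1 (lam k s))| <=
    2 * gronwall_factor M T * (M * gronwall_factor M T + 2) ^+ k * kap.
Proof.
move: k s; pose D j s := rad s - (r (lam j s) + eps * r1 (lam j s)).
apply: (@jump_gronwall R sigma n D T M M kap T M0 M0 kap0).
- move=> j t jn [/andP[js sT] _].
  by rewrite lerBlDr (le_trans sT)// lerDl sigma_ge0.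
- rewrite /D /lam subrr mulr0 addr0 /grid mul0r sigma0.
  have r00' : r 0 = r0 by case: det => _ <- _ _; rewrite (right_lim_cadlag cr (lexx 0)).
  have r10 : r1 0 = 0 by case: fl => _ E _ _; rewrite -(right_lim_cadlag cr1 (lexx 0)).
  by rewrite rad0 r00' r10 mulr0 addr0 subrr normr0.
- move=> j a jn ja.
  have lamE : lam j.+1 (sigma j.+1) = grid j.+1 by rewrite /lam subrr mulr0 addr0.
  rewrite /D lamE rad_jump// r_jump.
  have -> : r1 (grid j.+1) = derive1 h (left_lim r (grid j.+1)) * left_lim r1 (grid j.+1).
    by case: fl => _ _ <- _; rewrite (right_lim_cadlag cr1 (grid_ge0 j.+1)).
  set x := left_lim rad _; set y := left_lim r _; set z := left_lim r1 _.
  have gT : grid j.+1 <= T.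
    by rewrite (le_trans _ (ltW NT))// /grid ler_pM2r// ler_nat -nN.
  have jlt : grid j < grid j.+1 by rewrite gridS ltrDl.
  have zS : `|z| <= S.
    apply: (left_lim_norm_le cr1 (grid_ge0 j) jlt) => t /andP[jt tj]; apply: r1S.
    by rewrite (le_trans (grid_ge0 j) jt) (le_trans (ltW tj) gT).
  have xyz : `|x - y - eps * z| <= a.
    have sj0 : 0 < sigma j.+1 by exact: le_lt_trans (sigma_ge0 (ltnW jn)) (sigma_lt jn).
    have gj0 : 0 < grid j.+1 by exact: le_lt_trans (grid_ge0 j) jlt.
    have lamE' : grid j + m j * (sigma j.+1 - sigma j) = grid j.+1 := lam_end jn.
    have lx := left_lim_cvg crad sj0.
    have ly : r (lam j s) @[s --> (sigma j.+1)^'-] --> y.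
      apply: (@affine_at_left R r (sigma j) (grid j) (sigma j.+1) (m j) y (m0 j)).
      by rewrite lamE'; exact: left_lim_cvg.
    have lz : r1 (lam j s) @[s --> (sigma j.+1)^'-] --> z.
      apply: (@affine_at_left R r1 (sigma j) (grid j) (sigma j.+1) (m j) z (m0 j)).
      by rewrite lamE'; exact: left_lim_cvg.
    have lez : eps * r1 (lam j s) @[s --> (sigma j.+1)^'-] --> eps * z.
      by apply: cvgM lz; exact: cvg_cst.
    have lD : `|rad s - r (lam j s) - eps * r1 (lam j s)| @[s --> (sigma j.+1)^'-] -->
        `|x - y - eps * z|.
      by apply: cvg_norm; exact: (cvgB (cvgB lx ly) lez).
    apply: (cvgr_to_le lD); near=> t.
    have -> : rad t - r (lam j t) - eps * r1 (lam j t) = D j t by rewrite /D; lra.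
    apply: ja; split; last by move=> _; near: t; exact: nbhs_left_lt.
    apply/andP; split; first by near: t; apply: nbhs_left_ge; exact: sigma_lt.
    apply: le_trans (sigma_leT jn); apply: ltW; near: t; exact: nbhs_left_lt.
  have := taylor_remainder x y (eps * z) dh ddh h1M h2M.
  have -> : h x - h y - derive1 h y * (eps * z) = h x - (h y + eps * (derive1 h y * z)) by lra.
  move=> /le_trans; apply; apply: lerD; first by rewrite ler_wpM2l.
  apply: le_trans kap_sq.
  rewrite ler_wpM2l// -[leLHS]real_normK ?num_real// ler_sqr ?nnegrE ?mulr_ge0//.
  by rewrite normrM ger0_norm// ler_wpM2l.
- move=> j t jn jt; have [c1 c2 c3] := rad_segment jn jt.
  have jt' : sigma j <= t <= T by case: jt.
  have jN : (j <= N)%N by rewrite -nN.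
  have lt := lam_segment jn jt; rewrite nN in lt.
  have [d1 d2] := r_segment jN lt.
  have [e1 e2 e3] := fluctuation_segment cw fl jN lt.
  have jt1 : sigma j <= t by case/andP: jt'.
  have L1 := within_continuous_affine (m0 j) jt1 d1.
  have L2 := within_continuous_affine (m0 j) jt1 e2.
  exists (fun s => (rad s - eps * w s) - (r (lam j s) + eps * (r1 (lam j s) - w (lam j s)))).
  exists (fun s => b (rad s) - m j * (b (r (lam j s)) + eps * (derive1 b (r (lam j s)) * r1 (lam j s)))).
  have inner : forall s, sigma j < s < t -> grid j < lam j s < lam j t.
    by move=> s' /andP[js st]; rewrite /lam ltrDl mulr_gt0 ?subr_gt0//= ltrD2l ltr_pM2l// ltrD2r.
  split.
  + apply: within_continuousB c2 _; apply: within_continuousD L1 _.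
    exact: within_continuousM_cst.
  + move=> s js; have sj := segmentW jt js.
    apply: le_trans kap_om.
    have -> : D j s - (rad s - eps * w s - (r (lam j s) + eps * (r1 (lam j s) - w (lam j s)))) =
       eps * (w s - w (lam j s)) by rewrite /D; lra.
    by rewrite normrM ger0_norm// ler_wpM2l// wom.
  + move=> s js; have g1 := is_derive_affine (d2 _ (inner s js)).
    have g2 := is_derive_affine (e3 _ (inner s js)).
    apply: (is_derive_eq (is_deriveB (c3 s js) (is_deriveD g1 (is_deriveZ eps g2)))).
    by rewrite /GRing.scale/=; lra.
  + move=> s js; have js' : sigma j <= s <= t by case/andP: js => /ltW -> /ltW ->.
    have sj := segmentW jt js'; have sl := lam_segment jn sj.
    have r1s : `|r1 (lam j s)| <= S.
      apply: r1S; case: sl => /andP[h1 ->] _; rewrite andbT.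
      exact: le_trans (grid_ge0 j) h1.
    set x := rad s; set y := r (lam j s); set z := r1 (lam j s).
    have -> : b x - m j * (b y + eps * (derive1 b y * z)) =
       (b x - b y - derive1 b y * (eps * z)) - (m j - 1) * (b y + eps * (derive1 b y * z)) by lra.
    apply: le_trans (ler_normB _ _) _.
    have t1 : `|b x - b y - derive1 b y * (eps * z)| <= M * `|D j s| + M * (eps * S) ^+ 2.
      apply: le_trans (taylor_remainder x y (eps * z) db ddb b1M b2M) _.
      rewrite /D opprD addrA lerD2l ler_wpM2l//.
      rewrite -[leLHS]real_normK ?num_real// ler_sqr ?nnegrE ?mulr_ge0//.
      by rewrite normrM ger0_norm// ler_wpM2l.
    have t2 : `|(m j - 1) * (b y + eps * (derive1 b y * z))| <= rho * (M * (1 + S)).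
      rewrite normrM ler_pM// ?mrho//.
      apply: le_trans (ler_normD _ _) _; rewrite mulrDr mulr1 lerD//.
      rewrite !normrM ger0_norm// -[leRHS]mul1r ler_pM// ?mulr_ge0//.
      by rewrite ler_pM.
    by apply: le_trans (lerD t1 t2) _; rewrite -addrA lerD2l.
Unshelve. all: by end_near. Qed.

End Comparison.
End Perturbed.

Lemma euclidean_norm_le (u : @plane R) : euclidean_norm u <= `|u.1| + `|u.2|.
Proof.
rewrite /euclidean_norm -(ger0_norm (addr_ge0 (normr_ge0 u.1) (normr_ge0 u.2))) -sqrtr_sqr.
rewrite ler_sqrt ?sqr_ge0// sqrrD !real_normK ?num_real// -addrA.
by rewrite addrCA addrC lerDl mulrn_wge0// mulr_ge0.
Qed.

Let det_theta t : 0 <= t <= T -> `|theta t| <= T.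
Proof.
move=> tT; have g0 : grid 0%N = 0 by rewrite /grid mul0r.
have [k kN st] := segment_cover N g0 tT.
have [_ ->] := det_segment kN st; case: st => /andP[kt _] _.
rewrite ger0_norm ?subr_ge0//; case/andP: tT => _ tT.
by rewrite (le_trans _ tT)// gerBl.
Qed.

(** If every impact is displaced by less than this, none crosses [T];
    [alpha] is there as the gap between consecutive impacts. *)
Definition impact_margin : R := Num.min alpha (Num.min (T - N%:R * alpha) (N.+1%:R * alpha - T)).

Lemma impact_margin_gt0 : 0 < impact_margin.
Proof. by rewrite !lt_min alpha0 !subr_gt0 NT TN. Qed.

Section Realization.
Variables (w beta rad Th r1 : R -> R) (p eps gamma K : R).
Hypotheses (r00 : 0 <= r0) (p0 : 0 < p) (eps0 : 0 < eps) (eps1 : eps < 1).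
Hypotheses (gamma0 : 0 < gamma) (K0 : 0 <= K).
Hypotheses (cw : {within `[0, +oo[, continuous w}) (cbeta : {within `[0, +oo[, continuous beta}).
Hypothesis wK : forall s t, 0 <= s <= T -> 0 <= t <= T -> `|w t - w s| <= K * `|t - s| `^ gamma.
Hypothesis betaK : forall s t, 0 <= s <= T -> 0 <= t <= T ->
  `|beta t - beta s| <= K * `|t - s| `^ gamma.
Hypothesis sol : perturbed_solution b h alpha r0 p eps w beta rad Th.
Hypothesis fl : fluctuation_solution b h alpha r w r1.

Let H := K * T `^ gamma.
Let del := eps `^ p * H.
Let H0 : 0 <= H. Proof. by rewrite mulr_ge0// powR_ge0. Qed.
Let del0 : 0 <= del. Proof. by rewrite mulr_ge0// powR_ge0. Qed.

Let osc (f : R -> R) :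
  (forall s t, 0 <= s <= T -> 0 <= t <= T -> `|f t - f s| <= K * `|t - s| `^ gamma) ->
  forall s t, 0 <= s <= T -> 0 <= t <= T -> `|f s - f t| <= H.
Proof.
move=> fK s t sT tT; apply: le_trans (fK t s tT sT) _.
rewrite ler_wpM2l//; apply: ge0_ler_powR; rewrite ?nnegrE ?(ltW gamma0) ?(ltW T0)//.
rewrite ler_norml; case/andP: sT => s0 sT; case/andP: tT => t0 tT.
by apply/andP; split; lra.
Qed.

Let wH := osc wK.
Let betaH := osc betaK.

Let betadel s t : 0 <= s <= T -> 0 <= t <= T -> `|eps `^ p * (beta s - beta t)| <= del.
Proof. by move=> sT tT; rewrite normrM ger0_norm ?powR_ge0// ler_wpM2l ?powR_ge0// betaH. Qed.

Let S := fluctuation_factor * H.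
Let r1S t : 0 <= t <= T -> `|r1 t| <= S. Proof. exact: (fluctuation_bound cw wH fl). Qed.

Let X := planar_path rad Th.
Let x (t : R) : @plane R := planar_path r theta t + eps *: planar_path r1 (fun=> 0) t.

Let planar_diff s t : euclidean_norm (X s - x t) <=
  `|rad s - (r t + eps * r1 t)| + `|Th s - theta t|.
Proof. by apply: le_trans (euclidean_norm_le _) _; rewrite /= scaler0 addr0. Qed.

Let crad : cadlag rad. Proof. by case: sol => [[]]. Qed.

(** Both paths are bounded separately.  There are at most [(T + H) / alpha]
    impacts, and the exponential comes from the product of as many resets. *)
Lemma skorohod_crude_bound (Mr : R) : (forall t, 0 <= t <= T -> `|r t| <= Mr) ->
  let A := gronwall_factor 0 T in
  ((skorohod T X x <= (2 * A * expR (ln (M * A + 2) * ((T + H) / alpha)) * (M + r0 + H)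
    + (Mr + S) + (T + H + T))%:E)%E : Prop).
Proof.
move=> rMr A; have A0 : 0 <= A by exact: gronwall_factor_ge0.
have [n [sigma [[sigma0 sigma_lt sigmaT] sigmaE sigmaU [rad0 radJ radD]]]] :=
  perturbed_segments alpha0 (ltW T0) cbeta betaH sol.
apply: skorohod_le_uniform => // t tT; apply: le_trans (planar_diff t t) _.
have [k kn st] := segment_cover n sigma0 tT.
have sk0 : 0 <= sigma k by rewrite -sigma0; exact: cuts_nondecreasing kn.
have kt : sigma k <= t by case: st => /andP[].
have tT' : t <= T by case/andP: tT.
have skT : 0 <= sigma k <= T by rewrite sk0 (le_trans kt).
have ep1 : eps `^ p <= 1.
  by rewrite -(powRr0 eps); apply: ger_powR; rewrite ?eps0 ltW.
have radB : `|rad t| <= 2 * A * expR (ln (M * A + 2) * ((T + H) / alpha)) * (M + r0 + H).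
  have dr : driven_on sigma n T (b \o rad) w eps rad by move=> j u jn ju; have [] := radD j u jn ju.
  have := perturbed_radius_bound (ltW eps0) (ltW eps1) r00 cw wH sigma0 sigmaT sigma_lt
     crad rad0 radJ dr kn st.
  move=> /le_trans; apply; rewrite ler_wpM2r ?addr_ge0//.
  rewrite ler_wpM2l ?mulr_ge0//.
  have B0 : 0 < M * A + 2 by rewrite ltr_wpDl// mulr_ge0.
  have B1 : 1 <= M * A + 2 by apply: (@le_trans _ _ 2); rewrite ?ler1n// lerDr mulr_ge0.
  rewrite -[in leLHS](lnK (x := M * A + 2)) ?posrE// -expRM_natr ler_expR ler_wpM2l ?ln_ge0//.
  rewrite ler_pdivlMr// -sigmaE// lerD ?(le_trans kt)//.
  apply: le_trans (ler_norm _) _; apply: le_trans (betadel skT _) _; first by rewrite lexx ltW.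
  by rewrite -[leRHS]mul1r ler_wpM2r.
apply: lerD.
  apply: le_trans (ler_normB _ _) _; apply: lerD => //.
  apply: le_trans (ler_normD _ _) _; apply: lerD; first exact: rMr.
  rewrite normrM ger0_norm ?(ltW eps0)// -[leRHS]mul1r ler_pM ?(ltW eps0) ?(ltW eps1)//.
  exact: r1S.
have [_ ->] := radD k t kn st.
apply: le_trans (ler_normB _ _) _; apply: lerD; last exact: det_theta.
apply: le_trans (ler_normD _ _) _; apply: lerD.
  by rewrite ger0_norm ?subr_ge0// (le_trans _ tT')// gerBl.
apply: le_trans (betadel tT skT) _.
by rewrite -[leRHS]mul1r ler_wpM2r.
Qed.

(** The angular perturbation is so small that impacts pair up with the
    deterministic ones; gaps of at least [impact_margin / 2] which change by at
    most [2 del] give slopes within [rho] of 1. *)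
Lemma skorohod_fine_bound : del <= impact_margin / 8 ->
  let A := gronwall_factor M T in
  let rho := 4 * del / impact_margin in
  let kap := eps * (K * (3 * del) `^ gamma) + M * (eps * S) ^+ 2 + rho * (M * (1 + S)) in
  ((skorohod T X x <= (Num.max (2 * rho)
    (2 * A * (M * A + 2) ^+ N * kap + (rho * T + del)))%:E)%E : Prop).
Proof.
move=> dm A rho kap; have A0 : 0 <= A by exact: gronwall_factor_ge0.
have g0 := impact_margin_gt0; set g := impact_margin in dm rho kap g0 *.
have [ga gT gN] : [/\ g <= alpha, g <= T - N%:R * alpha & g <= N.+1%:R * alpha - T].
  by split; rewrite /g /impact_margin ?ge_min ?lexx ?orbT.
have [n [sigma [[sigma0 sigma_lt sigmaT] sigmaE sigmaU [rad0 radJ radD]]]] :=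
  perturbed_segments alpha0 (ltW T0) cbeta betaH sol.
have z0 : 0 <= (0 : R) <= T by rewrite lexx ltW.
have TT : 0 <= T <= T by rewrite lexx ltW.
have sge0 k : (k <= n)%N -> 0 <= sigma k.
  by move=> kn; rewrite -sigma0; exact: cuts_nondecreasing kn.
have sleT k : (k <= n)%N -> sigma k <= T.
  by move=> kn; apply: le_trans sigmaT; exact: (cuts_nondecreasing sigma_lt kn (leqnn n)).
have snear k : (k <= n)%N -> `|sigma k - grid k| <= del.
  move=> kn; have skT : 0 <= sigma k <= T by rewrite sge0// sleT.
  by rewrite /grid -sigmaE// opprD addrA subrr add0r normrN betadel.
have nN : n = N.
  have := snear n (leqnn n); rewrite ler_norml => /andP[a1 a2].
  have := sigmaU n T (leqnn n); have := betadel TT z0; rewrite ler_norml => /andP[b1 b2] c1.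
  have {}c1 : T + eps `^ p * (beta T - beta 0) < n.+1%:R * alpha.
    by apply: c1; split; [rewrite sigmaT lexx|rewrite ltnn].
  rewrite /grid in a1 a2.
  have h1' : n%:R * alpha < N.+1%:R * alpha by lra.
  have h2' : N%:R * alpha < n.+1%:R * alpha by lra.
  move: h1' h2'; rewrite !ltr_pM2r// !ltr_nat !ltnS => h1' h2'.
  by apply/eqP; rewrite eqn_leq h1' h2'.
move: sigma_lt sigmaT sigmaE sigmaU radJ radD sge0 sleT snear; rewrite nN {n nN}.
move=> sigma_lt sigmaT sigmaE sigmaU radJ radD sge0 sleT snear.
pose s' (k : nat) := if (k <= N)%N then grid k else T.
pose sg' (k : nat) := if (k <= N)%N then sigma k else T.
have s'E k : (k <= N)%N -> s' k = grid k by rewrite /s' => ->.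
have sg'E k : (k <= N)%N -> sg' k = sigma k by rewrite /sg' => ->.
have s'N : s' N.+1 = T by rewrite /s' ltnn.
have sg'N : sg' N.+1 = T by rewrite /sg' ltnn.
have near' k : `|sg' k - s' k| <= del.
  by rewrite /sg' /s'; case: ifP => kN; [exact: snear|rewrite subrr normr0].
have gap' k : (k <= N)%N -> g <= s' k.+1 - s' k.
  rewrite leq_eqVlt => /predU1P[->|kN]; first by rewrite s'N s'E.
  by rewrite !s'E ?(ltnW kN)// gridS addrAC subrr add0r.
have gapdiff k : `|(s' k.+1 - s' k) - (sg' k.+1 - sg' k)| <= 2 * del.
  have -> : (s' k.+1 - s' k) - (sg' k.+1 - sg' k) = (sg' k - s' k) - (sg' k.+1 - s' k.+1) by lra.
  by apply: le_trans (ler_normB _ _) _; rewrite mulr_natl mulr2n lerD.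
have gaps k : (k <= N)%N -> g / 2 <= sg' k.+1 - sg' k.
  move=> kN; have := gap' k kN; have := gapdiff k; rewrite ler_norml => /andP[a1 a2] a3; lra.
have rhog : rho * (g / 2) = 2 * del.
  by rewrite /rho -mulrA (mulrA g^-1) mulVf ?gt_eqF// mul1r; lra.
have rho0 : 0 <= rho by rewrite /rho divr_ge0 ?(ltW g0)// mulr_ge0.
have rho1 : rho <= 2^-1 by rewrite /rho ler_pdivrMr//; lra.
have sg'lt k : (k <= N)%N -> sg' k < sg' k.+1.
  by move=> kN; rewrite -subr_gt0; apply: lt_le_trans (gaps k kN); rewrite divr_gt0.
have gapr k : (k <= N)%N ->
    `|(s' k.+1 - s' k) - (sg' k.+1 - sg' k)| <= rho * (sg' k.+1 - sg' k).
  move=> kN; apply: le_trans (gapdiff k) _.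
  by rewrite -rhog ler_wpM2l// gaps.
pose m (k : nat) := if (k <= N)%N then (s' k.+1 - s' k) / (sg' k.+1 - sg' k) else 1.
have mE k : (k <= N)%N -> m k = (s' k.+1 - s' k) / (sg' k.+1 - sg' k) by rewrite /m => ->.
have mgap k : (k <= N)%N -> m k * (sg' k.+1 - sg' k) = s' k.+1 - s' k.
  by move=> kN; rewrite mE// divfK// gt_eqF// subr_gt0 sg'lt.
have m0 k : 0 < m k.
  rewrite /m; case: ifP => // kN; rewrite divr_gt0// ?subr_gt0 ?sg'lt//.
  by rewrite -subr_gt0; apply: lt_le_trans (gap' k kN).
have m1gap k : (k <= N)%N -> (m k - 1) * (sg' k.+1 - sg' k) =
    (s' k.+1 - s' k) - (sg' k.+1 - sg' k) by move=> kN; rewrite mulrBl mgap// mul1r.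
have mrho k : (k <= N)%N -> `|m k - 1| <= rho.
  move=> kN; have d0 : 0 < sg' k.+1 - sg' k by rewrite subr_gt0 sg'lt.
  by rewrite -(ler_pM2r d0) -[X in _ * X <= _]gtr0_norm// -normrM m1gap// gapr.
have segE k s : (k <= N)%N -> segment sigma N T k s -> sg' k <= s <= sg' k.+1.
  move=> kN [/andP[ks sT] sk]; rewrite sg'E// ks/=; move: kN.
  rewrite leq_eqVlt => /predU1P[kN|kN]; first by rewrite kN sg'N.
  by rewrite sg'E// ltW// sk.
pose lam k s := grid k + m k * (s - sigma k).
have lamle k s : (k <= N)%N -> s <= sg' k.+1 -> lam k s <= s' k.+1.
  move=> kN sk; rewrite /lam -(s'E k kN) -(sg'E k kN) -lerBrDl -mgap//.
  by rewrite ler_pM2l// lerD2r.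
have lamend k : (k < N)%N -> lam k (sigma k.+1) = grid k.+1.
  move=> kN; rewrite /lam -(s'E k (ltnW kN)) -(sg'E k (ltnW kN)) -(sg'E k.+1 kN) mgap ?(ltnW kN)//.
  by rewrite s'E ?s'E// ?(ltnW kN)//; lra.
have s'T k : (k <= N)%N -> s' k.+1 <= T.
  rewrite leq_eqVlt => /predU1P[->|kN]; first by rewrite s'N.
  rewrite s'E// (le_trans _ (ltW NT))// /grid ler_pM2r// ler_nat//.
have lamseg k s : (k <= N)%N -> segment sigma N T k s -> segment grid N T k (lam k s).
  move=> kN ks; have /andP[a1 a2] := segE k s kN ks; split.
    rewrite (le_trans (lamle k s kN a2) (s'T k kN)) andbT.
    by rewrite /lam lerDl mulr_ge0 ?(ltW (m0 k))// subr_ge0 -sg'E.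
  move=> kN'; rewrite -lamend// /lam ltrD2l ltr_pM2l// ltrD2r.
  by case: ks => _; apply.
have lamnear k s : (k <= N)%N -> segment sigma N T k s -> `|s - lam k s| <= 3 * del.
  move=> kN ks; have /andP[a1 a2] := segE k s kN ks.
  have -> : s - lam k s = (sg' k - s' k) - (m k - 1) * (s - sg' k).
    by rewrite /lam (s'E k kN) (sg'E k kN); lra.
  apply: le_trans (ler_normB _ _) _.
  have -> : 3 * del = del + 2 * del by lra.
  apply: lerD => //; apply: le_trans (gapdiff k); rewrite -m1gap// !normrM ler_wpM2l//.
  by rewrite !ger0_norm ?subr_ge0 ?(le_trans a1)// lerD2r.
have sT k s : (k <= N)%N -> segment sigma N T k s -> 0 <= s <= T.
  by move=> kN [/andP[ks ->] _]; rewrite andbT (le_trans _ ks)// sge0.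
have lT k s : (k <= N)%N -> segment sigma N T k s -> 0 <= lam k s <= T.
  by move=> kN /(lamseg k s kN)[/andP[ks ->] _]; rewrite andbT (le_trans (grid_ge0 k) ks).
have wom k s : (k <= N)%N -> segment sigma N T k s ->
    `|w s - w (lam k s)| <= K * (3 * del) `^ gamma.
  move=> kN ks; apply: le_trans (wK (lT k s kN ks) (sT k s kN ks)) _.
  rewrite ler_wpM2l//; apply: ge0_ler_powR; rewrite ?nnegrE ?(ltW gamma0)//.
    by rewrite mulr_ge0.
  exact: lamnear.
have S0 : 0 <= S by exact: le_trans (normr_ge0 _) (r1S z0).
have kap0 : 0 <= kap.
  apply: addr_ge0; first apply: addr_ge0.
  - by apply: mulr_ge0 (ltW eps0) _; apply: mulr_ge0 K0 _; exact: powR_ge0.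
  - by apply: mulr_ge0 M0 _; exact: sqr_ge0.
  - by apply: mulr_ge0 rho0 _; apply: mulr_ge0 M0 _; exact: addr_ge0.
have sg0 : sg' 0%N = 0 by rewrite sg'E.
have s0 : s' 0%N = 0 by rewrite s'E// /grid mul0r.
apply: (skorohod_retiming sg0 s0 sg'N s'N sg'lt rho0 rho1 gapr) => k t kN.
rewrite -mE// (s'E k kN) (sg'E k kN) -/(lam k t) => st'.
have {st'}st : segment sigma N T k t.
  case: st' => ks sk; split; first by rewrite -sg'E.
  by move=> kN'; rewrite -(sg'E k.+1 kN'); exact: sk.
apply: le_trans (planar_diff t (lam k t)) _; apply: lerD.
  have dr : driven_on sigma N T (b \o rad) w eps rad.
    by move=> j u jn ju; have [] := radD j u jn ju.
  have := comparison_bound (ltW eps0) (ltW eps1) cw sigma0 sigmaT sigma_lt crad rad0 radJ dr erefl fl r1S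
    m0 mrho lamseg lamend wom kN st.
  move=> /le_trans; apply; rewrite -/kap; apply: ler_wpM2r kap0 _ _ _.
  apply: ler_wpM2l; first exact: mulr_ge0.
  rewrite ler_weXn2l//.
  by apply: (@le_trans _ _ 2); rewrite ?ler1n// lerDr mulr_ge0.
have [_ ->] := radD k t kN st.
have [_ ->] := det_segment kN (lamseg k t kN st).
have -> : t - sigma k + eps `^ p * (beta t - beta (sigma k)) - (lam k t - grid k) =
   (1 - m k) * (t - sigma k) + eps `^ p * (beta t - beta (sigma k)) by rewrite /lam; lra.
apply: le_trans (ler_normD _ _) _; apply: lerD; last first.
  by apply: betadel; [exact: sT st|rewrite sge0// sleT].
rewrite normrM ler_pM//; first by rewrite distrC mrho.
case: st => /andP[kt tT] _; rewrite ger0_norm ?subr_ge0//.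
by rewrite (le_trans _ tT)// gerBl sge0.
Qed.

End Realization.

Lemma fluctuation_factor_ge0 : 0 <= fluctuation_factor.
Proof.
rewrite /fluctuation_factor; have := gronwall_factor_ge0 alpha M0.
move: (gronwall_factor M alpha) => A A0.
by rewrite mulr_ge0 ?mulr_ge0 ?exprn_ge0// addr_ge0// mulr_ge0.
Qed.

(** Either [del] is small and the fine bound applies, or
    [1 <= 8 del / impact_margin] and the crude one does.  The rate [c] exceeds 2
    because of the number of impacts in the crude bound. *)
Lemma pathwise_bound (p gamma : R) : 0 <= r0 -> 0 < p -> 0 < gamma -> gamma <= 1 ->
  exists c C : R, [/\ 0 < c, 0 < C &
    forall (eps K : R) (w beta rad Th r1 : R -> R), 0 < eps -> eps < 1 -> 0 <= K ->
      {within `[0, +oo[, continuous w} -> {within `[0, +oo[, continuous beta} ->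
      (forall s t, 0 <= s <= T -> 0 <= t <= T -> `|w t - w s| <= K * `|t - s| `^ gamma) ->
      (forall s t, 0 <= s <= T -> 0 <= t <= T ->
         `|beta t - beta s| <= K * `|t - s| `^ gamma) ->
      perturbed_solution b h alpha r0 p eps w beta rad Th ->
      fluctuation_solution b h alpha r w r1 ->
      (skorohod T (planar_path rad Th)
        (fun t => (planar_path r theta t + eps *: planar_path r1 (fun=> 0) t)%R) <=
       (C * error_rate eps p gamma * expR (c * K))%:E)%E].
Proof.
move=> r00 p0 gamma0 gamma1.
have [Mr rMr] := cadlag_bounded T cr (lexx 0).
have z0 : 0 <= (0 : R) <= T by rewrite lexx ltW.
have Mr0 : 0 <= Mr by exact: le_trans (normr_ge0 _) (rMr 0 z0).
have F0 := fluctuation_factor_ge0; have g0 := impact_margin_gt0.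
have A00 := gronwall_factor_ge0 T (lexx 0); have A10 := gronwall_factor_ge0 T M0.
pose tau := T `^ gamma; have tau0 : 0 <= tau by exact: powR_ge0.
pose lnB := ln (M * gronwall_factor 0 T + 2).
have lnB0 : 0 <= lnB.
  by rewrite ln_ge0// (@le_trans _ _ 2)// ?ler1n// lerDr mulr_ge0.
pose P := 2 * gronwall_factor M T * (M * gronwall_factor M T + 2) ^+ N.
have P0 : 0 <= P.
  by rewrite /P mulr_ge0 ?mulr_ge0 ?exprn_ge0// addr_ge0// mulr_ge0.
pose F := fluctuation_factor; rewrite -/F in F0.
pose G := impact_margin^-1; have G0 : 0 <= G by rewrite invr_ge0 ltW.
have TT0 := ltW T0.
pose Cf := fine_constant tau M F P G T.
have Cf0 : 0 <= Cf by exact: fine_constant_ge0.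
pose Cc := crude_constant tau M F G T (gronwall_factor 0 T) lnB alpha r0 Mr.
have Cc0 : 0 <= Cc by exact: crude_constant_ge0.
pose c1 := lnB * (tau / alpha).
have c10 : 0 <= c1 by rewrite mulr_ge0// divr_ge0// ltW.
exists (2 + c1), (Cf + Cc + 1); split.
- by rewrite ltr_wpDr.
- by rewrite ltr_wpDl// addr_ge0.
move=> eps K w beta rad Th r1 eps0 eps1 K0 cw cbeta wK betaK sol fl.
have e0 : 0 <= error_rate eps p gamma by have [] := error_rate_ge eps p gamma.
pose del := eps `^ p * (K * tau).
have [small|/ltW big] := leP del (impact_margin / 8).
  have := skorohod_fine_bound eps0 eps1 gamma0 K0 cw cbeta wK betaK sol fl small.
  move=> /= /le_trans; apply; rewrite lee_fin.
  apply: le_trans (fine_estimate eps0 K0 gamma0 gamma1 tau0 M0 F0 G0 TT0 P0 erefl erefl) _.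
  apply: ler_pM; [exact: mulr_ge0|exact: expR_ge0| |].
    by rewrite ler_wpM2r// -addrA lerDl addr_ge0.
  by rewrite ler_expR ler_wpM2r// lerDl.
have := skorohod_crude_bound r00 p0 eps0 eps1 gamma0 K0 cw cbeta wK betaK sol fl rMr.
move=> /= /le_trans; apply; rewrite lee_fin.
have big' : 1 <= 8 * del * G by rewrite /G ler_pdivlMr// mul1r; lra.
apply: le_trans (crude_estimate gamma K0 tau0 M0 F0 G0 TT0 A00 lnB0 alpha0 r00 Mr0 big') _.
rewrite ler_wpM2r ?expR_ge0// ler_wpM2r// addrAC addrC lerDl.
exact: addr_ge0.
Qed.

End Pathwise.

(** * Exponential moments of the Hoelder constant of a Brownian path *)

Section Chaining.
Context {R : realType}.
Variables (w : R -> R) (T rho K : R).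
Hypotheses (T0 : 0 < T) (rho0 : 0 < rho) (rho1 : rho < 1) (K0 : 0 <= K).
Hypothesis cw : {within `[0, +oo[, continuous w}.
Hypothesis dyadic : forall n k, (k < 2 ^ n)%N ->
  `|w (k.+1%:R * T / 2 ^+ n) - w (k%:R * T / 2 ^+ n)| <= K * rho ^+ n.

Let idx n (t : R) := Num.truncn (2 ^+ n * t / T).
Let grid n t := (idx n t)%:R * T / 2 ^+ n.

Let p2 n : 0 < 2 ^+ n :> R. Proof. by rewrite exprn_gt0. Qed.

Let idxP n t : 0 <= t -> (idx n t)%:R <= 2 ^+ n * t / T < (idx n t).+1%:R.
Proof. by move=> t0; apply: truncn_itv; rewrite divr_ge0 ?mulr_ge0// ltW. Qed.

Let idx_le n t : 0 <= t <= T -> (idx n t <= 2 ^ n)%N.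
Proof.
move=> /andP[t0 tT]; rewrite -(ler_nat R) natrX.
have /andP[h _] := idxP n t0; apply: le_trans h _.
by rewrite ler_pdivrMr// ler_pM2l.
Qed.

Let grid_step n t : 0 <= t <= T -> `|w (grid n.+1 t) - w (grid n t)| <= K * rho ^+ n.+1.
Proof.
move=> tT; have t0 : 0 <= t by case/andP: tT.
have K1 : 0 <= K * rho ^+ n.+1 by rewrite mulr_ge0// exprn_ge0// ltW.
have /andP[a1 a2] := idxP n t0; have /andP[b1 b2] := idxP n.+1 t0.
have E : 2 ^+ n.+1 * t / T = 2 * (2 ^+ n * t / T) by rewrite exprS; lra.
rewrite E in b1 b2.
have h1 : (idx n t * 2 <= idx n.+1 t)%N.
  rewrite -ltnS -(ltr_nat R) natrM; apply: le_lt_trans b2; lra.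
have h2 : (idx n.+1 t < (idx n t).+1 * 2)%N.
  rewrite -(ltr_nat R) natrM; apply: le_lt_trans b1 _; lra.
have gridE : grid n t = (idx n t * 2)%N%:R * T / 2 ^+ n.+1.
  rewrite /grid natrM exprS invfM; lra.
have [e|e] : idx n.+1 t = (idx n t * 2)%N \/ idx n.+1 t = (idx n t * 2).+1.
  by move: h1 h2; rewrite mulSn leq_eqVlt => /predU1P[->|]; [left|right; apply/eqP; rewrite eqn_leq -ltnS; apply/andP].
- by rewrite gridE /grid e subrr normr0.
- by rewrite gridE {1}/grid e; apply: dyadic; rewrite -e; exact: idx_le.
Qed.

Let D := rho / (1 - rho).
Let r1 : 0 < 1 - rho. Proof. by rewrite subr_gt0. Qed.

Let grid_steps n m t : 0 <= t <= T ->
  `|w (grid (n + m) t) - w (grid n t)| <= K * D * (rho ^+ n - rho ^+ (n + m)).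
Proof.
move=> tT; elim: m => [|m ih]; first by rewrite addn0 !subrr normr0 mulr0.
rewrite addnS; have -> : w (grid (n + m).+1 t) - w (grid n t) =
  (w (grid (n + m).+1 t) - w (grid (n + m) t)) + (w (grid (n + m) t) - w (grid n t)) by lra.
apply: le_trans (ler_normD _ _) _; apply: le_trans (lerD (grid_step _ tT) ih) _.
rewrite le_eqVlt; apply/orP; left; apply/eqP.
have h : D * (rho ^+ (n + m) - rho ^+ (n + m).+1) = rho ^+ (n + m).+1.
  rewrite exprS -[X in X - _]mul1r -mulrBl mulrA /D divfK ?gt_eqF//.
by rewrite -[in LHS]h; lra.
Qed.

Let grid_cvg t : 0 <= t -> grid n t @[n --> \oo] --> t.
Proof.
move=> t0; apply: (@squeeze_cvgr _ _ _ _ (fun n => t - T * 2^-1 ^+ n) (cst t)).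
- apply: nearW => n; have /andP[a1 a2] := idxP n t0.
  rewrite /grid; apply/andP; split.
    rewrite ler_pdivlMr// mulrBl -mulrA -exprMn mulVf// expr1n mulr1.
    by move: a2; rewrite ltr_pdivrMr// -natr1 => /ltW; lra.
  by rewrite /= ler_pdivrMr//; move: a1; rewrite ler_pdivlMr//; lra.
- rewrite -[X in _ --> X]subr0; apply: cvgB; first exact: cvg_cst.
  have := @cvg_geometric R T 2^-1; apply.
  by rewrite ger0_norm ?invr_ge0// invf_lt1// ltr1n.
- exact: cvg_cst.
Qed.

Let wgrid_cvg t : 0 <= t -> w (grid n t) @[n --> \oo] --> w t.
Proof.
rewrite le_eqVlt => /predU1P[<-|t0].
  have -> : (fun n => w (grid n 0)) = cst (w 0); last exact: cvg_cst.
  by apply/funext => n; rewrite /grid /idx mulr0 mul0r truncn0 !mul0r.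
have ct : {for t, continuous w}.
  by move: cw => /continuous_within_itvcyP[h _]; apply: h; rewrite in_itv/= andbT.
exact: (cvg_comp (grid ^~ t) w (grid_cvg (ltW t0)) ct).
Qed.

Let to_grid n t : 0 <= t <= T -> `|w t - w (grid n t)| <= K * D * rho ^+ n.
Proof.
move=> tT; have t0 : 0 <= t by case/andP: tT.
have c : `|w (grid m t) - w (grid n t)| @[m --> \oo] --> `|w t - w (grid n t)|.
  by apply: cvg_norm; apply: cvgB; [exact: wgrid_cvg|exact: cvg_cst].
apply: (cvgr_to_le c); exists n => // m /= nm.
rewrite -(subnKC nm); apply: le_trans (grid_steps _ _ tT) _.
rewrite ler_wpM2l ?mulr_ge0 ?invr_ge0 ?(ltW rho0) ?(ltW r1)//.
by rewrite gerBl exprn_ge0// ltW.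
Qed.

Let close_grid n s t : 0 <= s <= T -> 0 <= t <= T -> s <= t -> t - s <= T / 2 ^+ n ->
  `|w (grid n t) - w (grid n s)| <= K * rho ^+ n.
Proof.
move=> sT tT st h; have s0 : 0 <= s by case/andP: sT.
have t0 : 0 <= t by case/andP: tT.
have K1 : 0 <= K * rho ^+ n by rewrite mulr_ge0// exprn_ge0// ltW.
have /andP[a1 a2] := idxP n s0; have /andP[b1 b2] := idxP n t0.
have E : 2 ^+ n * t / T <= 2 ^+ n * s / T + 1.
  rewrite -(ler_pM2r T0) mulrDl mul1r !divfK ?gt_eqF//.
  by move: h; rewrite ler_pdivlMr//; lra.
have E' : 2 ^+ n * s / T <= 2 ^+ n * t / T.
  by rewrite ler_pM2r ?invr_gt0// ler_pM2l.
have h1 : (idx n s <= idx n t)%N by rewrite -ltnS -(ltr_nat R); lra.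
have h2 : (idx n t <= (idx n s).+1)%N.
  by rewrite -ltnS -(ltr_nat R) -[(idx n s).+2%:R]natr1; lra.
move: h1; rewrite leq_eqVlt => /predU1P[e|h1].
  by rewrite /grid e subrr normr0.
have e : idx n t = (idx n s).+1 by apply/eqP; rewrite eqn_leq h2 h1.
by rewrite /grid e; apply: dyadic; rewrite -e; exact: idx_le.
Qed.

(** Chaining: a time is approached by its dyadic approximations from the left.
    At each level two consecutive approximations are equal or neighbours, so the
    increments sum to a geometric series; two times closer than the mesh have
    equal or neighbouring approximations. *)
Lemma dyadic_modulus n s t : 0 <= s <= T -> 0 <= t <= T ->
  `|t - s| <= T / 2 ^+ n -> `|w t - w s| <= K * (1 + 2 * D) * rho ^+ n.
Proof.
wlog st : s t / s <= t => [hw sT tT|sT tT].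
  have [st|/ltW ts] := leP s t; first exact: hw.
  by rewrite distrC => /(hw _ _ ts tT sT); rewrite distrC.
rewrite ger0_norm ?subr_ge0// => /(close_grid sT tT st) h.
have -> : w t - w s = (w t - w (grid n t)) + (w (grid n t) - w (grid n s)) + (w (grid n s) - w s) by lra.
apply: le_trans (ler_normD _ _) _.
apply: le_trans (lerD (le_trans (ler_normD _ _) (lerD (to_grid n tT) h)) (_ : _ <= K * D * rho ^+ n)) _.
  by rewrite distrC; exact: to_grid.
lra.
Qed.

End Chaining.

(** [dyadic_modulus] is used at the level [n] for which
    [T / 2^(n+1) < |t - s| <= T / 2^n]. *)
Lemma dyadic_holder {R : realType} (w : R -> R) (T gamma K : R) :
    0 < T -> 0 < gamma -> 0 <= K ->
    {within `[0, +oo[, continuous w} ->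
    (forall n k, (k < 2 ^ n)%N ->
      `|w (k.+1%:R * T / 2 ^+ n) - w (k%:R * T / 2 ^+ n)| <= K * (2 `^ (- gamma)) ^+ n) ->
  forall s t, 0 <= s <= T -> 0 <= t <= T ->
    `|w t - w s| <= K * (1 + 2 * (2 `^ (- gamma) / (1 - 2 `^ (- gamma)))) * (2 / T) `^ gamma
      * `|t - s| `^ gamma.
Proof.
move=> T0 g0 K0 cw dy s t sT tT.
set rho := 2 `^ (- gamma).
have rho0 : 0 < rho by exact: powR_gt0.
have rho1 : rho < 1.
  rewrite /rho powRN invf_lt1 ?powR_gt0//.
  have : 1 `^ gamma < 2 `^ gamma; last by rewrite powR1.
  by apply: gt0_ltr_powR; rewrite ?nnegrE ?ler0n// ltr1n.
have C0 : 0 <= K * (1 + 2 * (rho / (1 - rho))).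
  rewrite mulr_ge0// addr_ge0// mulr_ge0// divr_ge0 ?(ltW rho0)//.
  by rewrite subr_ge0 ltW.
have [->|ne] := eqVneq t s.
  by rewrite !subrr normr0 mulr_ge0 ?powR_ge0// mulr_ge0 ?powR_ge0.
have d0 : 0 < `|t - s| by rewrite normr_gt0 subr_eq0.
have dT : `|t - s| <= T.
  by rewrite ler_norml; case/andP: sT; case/andP: tT => *; apply/andP; split; lra.
have exn : exists n, T / 2 ^+ n.+1 < `|t - s|.
  exists (Num.truncn (T / `|t - s|)).+1; set n := Num.truncn _.
  rewrite ltr_pdivrMr ?exprn_gt0// mulrC -ltr_pdivrMr//.
  apply: lt_trans (truncnS_gt _) _; rewrite -/n -natrX ltr_nat.
  by apply: ltn_trans (ltnSn n.+1) _; exact: ltn_expl.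
case: (ex_minnP exn) => n Hn nmin.
have dn : `|t - s| <= T / 2 ^+ n.
  case: n nmin {Hn} => [|m] nmin; first by rewrite expr0 divr1.
  by rewrite leNgt; apply/negP => /nmin; rewrite ltnn.
apply: le_trans (@dyadic_modulus R w T rho K T0 rho0 rho1 K0 cw dy n s t sT tT dn) _.
rewrite -[leRHS]mulrA ler_wpM2l// -powRM ?divr_ge0 ?(ltW T0)//.
have -> : rho ^+ n = (2^-1 ^+ n) `^ gamma.
  rewrite /rho -powR_mulrn ?powR_ge0// -powRrM -[2^-1 ^+ n]powR_mulrn ?invr_ge0//.
  by rewrite -powR_inv1// -!powRrM; congr (_ `^ _); lra.
apply: ge0_ler_powR; rewrite ?nnegrE ?(ltW g0)// ?exprn_ge0 ?invr_ge0//.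
  by rewrite mulr_ge0// divr_ge0// ltW.
rewrite mulrAC -(ler_pM2r T0) divfK ?gt_eqF//.
by move: Hn; rewrite exprS invfM exprVn => /ltW; lra.
Qed.

Section GaussianMoment.
Context {R : realType}.
Local Notation mu := (@lebesgue_measure R).

(** The density of the normal law agrees almost everywhere with the
    Radon-Nikodym derivative, both having the same integrals. *)
Lemma ge0_integral_normal_prob (m s : R) (f : R -> \bar R) :
    measurable_fun setT f -> (forall x, (0 <= f x)%E) ->
  (\int[normal_prob m s]_x f x = \int[mu]_x (f x * (normal_pdf m s x)%:E))%E.
Proof.
move=> mf f0; have dom := @normal_prob_dominates R m s.
rewrite -(Radon_Nikodym_SigmaFinite.change_of_variables dom f0 measurableT mf).
have gi := Radon_Nikodym_SigmaFinite.f_integrable dom.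
have mpdf : measurable_fun setT (fun x => (normal_pdf m s x)%:E).
  by apply/measurable_EFinP; exact: measurable_normal_pdf.
apply: ae_eq_integral => //.
- by apply: emeasurable_funM => //; exact: measurable_int gi.
- exact: emeasurable_funM.
- apply: ae_eqe_mul2l; apply: integral_ae_eq => //.
  by move=> E _ mE; rewrite -(Radon_Nikodym_SigmaFinite.f_integral dom).
Qed.

(** Completing the square: an exponential weight moves the mean. *)
Lemma normal_exp_tilt (s v x : R) : s != 0 ->
  expR (v * x) * normal_pdf 0 s x =
  expR (v ^+ 2 * s ^+ 2 / 2) * normal_pdf (v * s ^+ 2) s x.
Proof.
move=> s0; rewrite !normal_pdfE// /normal_fun.
rewrite mulrCA [RHS]mulrCA; congr (_ * _); rewrite -!expRD; congr expR.
have sc : s ^+ 2 * (s ^+ 2 *+ 2)^-1 = 2^-1.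
  by rewrite -mulr_natr invfM mulrA divff ?mul1r// sqrf_eq0.
set c := _^-1 in sc *; set q := s ^+ 2 in sc *.
have -> : v * x = 2 * (v * x) * (q * c) by rewrite sc; lra.
have -> : v ^+ 2 * q / 2 = v ^+ 2 * q * (q * c) by rewrite sc; lra.
lra.
Qed.

Lemma measurable_exp_linear (v : R) :
  measurable_fun [set: measurableTypeR R] (fun x : measurableTypeR R => (expR (v * x))%:E).
Proof.
apply/measurable_EFinP.
apply: (@measurableT_comp _ _ _ _ _ _ (@expR R) _ (fun x : measurableTypeR R => v * x)).
  exact: measurable_expR.
exact: mulrl_measurable.
Qed.

Lemma measurable_exp_linear_norm (v : R) :
  measurable_fun [set: measurableTypeR R] (fun x : measurableTypeR R => (expR (v * `|x|))%:E).
Proof.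
apply/measurable_EFinP.
apply: (@measurableT_comp _ _ _ _ _ _ (@expR R) _ (fun x : measurableTypeR R => v * `|x|)).
  exact: measurable_expR.
apply: (@measurableT_comp _ _ _ _ _ _ ( *%R v) _ (fun x : measurableTypeR R => `|x|)).
  exact: mulrl_measurable.
exact: normr_measurable.
Qed.

Lemma normal_exp_moment (s v : R) : s != 0 ->
  (\int[normal_prob 0%R s]_x (expR (v * x))%:E = (expR (v ^+ 2 * s ^+ 2 / 2))%:E)%E.
Proof.
move=> s0; rewrite ge0_integral_normal_prob; last 2 first.
- exact: measurable_exp_linear.
- by move=> x; rewrite lee_fin expR_ge0.
under eq_integral do rewrite -EFinM normal_exp_tilt// EFinM.
rewrite ge0_integralZl//.
- by rewrite integral_normal_pdf mule1.
- by apply/measurable_EFinP; exact: measurable_normal_pdf.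
- by move=> x _; rewrite lee_fin normal_pdf_ge0.
Qed.

(** From [expR (v |x|) <= expR (v x) + expR (- v x)]. *)
Lemma normal_exp_abs_moment (s v : R) : s != 0 ->
  (\int[normal_prob 0%R s]_x (expR (v * `|x|))%:E <=
   (2 * expR (v ^+ 2 * s ^+ 2 / 2))%:E)%E.
Proof.
move=> s0.
apply: (@le_trans _ _ (\int[normal_prob 0%R s]_x
    ((expR (v * x))%:E + (expR (- v * x))%:E))%E).
  apply: ge0_le_integral => //.
  - exact: measurable_exp_linear_norm.
  - by apply: (@emeasurable_funD _ (measurableTypeR R)); exact: measurable_exp_linear.
  - move=> x _; rewrite -EFinD lee_fin.
    have [x0|/ltW x0] := ger0P x; first by rewrite lerDl expR_ge0.
    by rewrite mulrN mulNr lerDr expR_ge0.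
rewrite ge0_integralD//; [|exact: measurable_exp_linear..].
by rewrite !normal_exp_moment// sqrrN -EFinD lee_fin; lra.
Qed.

End GaussianMoment.

Lemma gaussian_increment_exp_moment {d} {Omega : measurableType d} {R : realType}
    (P : probability Omega R) (W : R -> {RV P >-> R}) (s t v : R) :
    gaussian_increments W -> 0 <= s -> s < t ->
  (\int[P]_w (expR (v * `|W t w - W s w|)%R)%:E <=
   (2 * expR (v ^+ 2 * (t - s) / 2))%:E)%E.
Proof.
move=> gW s0 st; have st0 : 0 < t - s by rewrite subr_gt0.
have mX : measurable_fun setT (fun w => W t w - W s w : measurableTypeR R).
  exact: measurable_funB.
rewrite (_ : (\int[P]_w _)%E =
  (\int[normal_prob 0%R (Num.sqrt (t - s))]_x (expR (v * `|x|))%:E)%E).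
  apply: le_trans (normal_exp_abs_moment _ _) _; first by rewrite gt_eqF// sqrtr_gt0.
  by rewrite sqr_sqrtr// ltW.
have := @ge0_integral_pushforward _ _ _ _ _ _ mX P setT _ measurableT (measurable_exp_linear_norm v).
rewrite preimage_setT => E.
rewrite -[LHS]E//.
by apply: eq_measure_integral => A mA _; exact: gW s t A s0 st mA.
Qed.

(** From [dl n <= exp (dl n)] with [y = exp (- dl)]. *)
Lemma linear_geometric_bounded {R : realType} (y : R) : 0 < y -> y < 1 ->
  exists M : R, forall n, n.+1%:R * y ^+ n <= M.
Proof.
move=> y0 y1; pose dl := - ln y.
have dl0 : 0 < dl by rewrite oppr_gt0 ln_lt0// y0.
exists (dl^-1 + 1) => n.
have yn0 : 0 < y ^+ n by rewrite exprn_gt0.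
have yE : y ^+ n = (expR (dl * n%:R))^-1.
  by rewrite -expRN mulNr opprK expRM_natr lnK.
have h : n%:R * y ^+ n <= dl^-1.
  rewrite yE ler_pdivrMr ?expR_gt0// ler_pdivlMl//.
  by apply: le_trans (expR_ge1Dx _); rewrite lerDr.
have h2 : y ^+ n <= 1 by rewrite exprn_ile1// ltW.
by rewrite -natr1 mulrDl mul1r lerD.
Qed.

Section HolderMoment.
Context {d} {Omega : measurableType d} {R : realType} (P : probability Omega R).
Variables (W : R -> {RV P >-> R}) (T gamma c : R).
Hypotheses (T0 : 0 < T) (g0 : 0 < gamma) (g1 : gamma < 2^-1) (c0 : 0 < c).
Hypothesis gW : gaussian_increments W.

Let rho : R := 2 `^ (- gamma).
Let rho0 : 0 < rho. Proof. exact: powR_gt0. Qed.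
Let v n := c * n.+1%:R * rho ^- n.
Let incr n k (w : Omega) : R := W (k.+1%:R * T / 2 ^+ n) w - W (k%:R * T / 2 ^+ n) w.
Let g n (w : Omega) : R := \sum_(k < 2 ^ n) (4^-1) ^+ n * expR (v n * `|incr n k w|).

(** If this series is at most [G], an increment of level [n] is at most
    [(ln G + n ln 4) rho^n / (c (n + 1))], that is, [rho^n] times a constant whose
    exponential is integrable.  The factor [4^-n] compensates for the [2^n]
    increments of level [n] and leaves a convergent series of expectations. *)
Definition dyadic_energy (w : Omega) : \bar R := (\sum_(n <oo) (g n w)%:E)%E.

Let g_ge0 n w : 0 <= g n w.
Proof. by apply: sumr_ge0 => k _; rewrite mulr_ge0 ?expR_ge0// exprn_ge0// invr_ge0. Qed.

Let mexp n k : measurable_fun setT (fun w => expR (v n * `|incr n k w|)).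
Proof.
apply: (@measurableT_comp _ _ _ _ _ _ (@expR R) _ (fun w => v n * `|incr n k w|)).
  exact: measurable_expR.
apply: (@measurableT_comp _ _ _ _ _ _ ( *%R (v n)) _ (fun w => `|incr n k w|)).
  exact: mulrl_measurable.
apply: (@measurableT_comp _ _ _ _ _ _ (fun x : R => `|x|) _ (incr n k)).
  exact: normr_measurable.
exact: measurable_funB.
Qed.

Let mterm n k : measurable_fun setT (fun w => (4^-1) ^+ n * expR (v n * `|incr n k w|)).
Proof.
apply: (@measurableT_comp _ _ _ _ _ _ ( *%R (4^-1 ^+ n : R)) _ (fun w => expR (v n * `|incr n k w|))).
  exact: mulrl_measurable.
exact: mexp.
Qed.

Let mg n : measurable_fun setT (fun w => (g n w)%:E).
Proof. by apply/measurable_EFinP; apply: measurable_sum => k; exact: mterm. Qed.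

Lemma measurable_dyadic_energy : measurable_fun setT dyadic_energy.
Proof.
apply: (ge0_emeasurable_sum (P := predT)) => // k w _ _.
by rewrite lee_fin g_ge0.
Qed.

Lemma dyadic_energy_ge0 w : (0 <= dyadic_energy w)%E.
Proof. by apply: nneseries_ge0 => n _ _; rewrite lee_fin g_ge0. Qed.

(** The variance of an increment of level [n], of order [2^-n], times the square
    of its weight [v n], of order [n^2 2^(2 gamma n)], stays bounded exactly
    because [gamma < 1/2].  The [2^n] increments of level [n] then contribute
    at most a multiple of [2^-n]. *)
Lemma integral_dyadic_energy : (\int[P]_w dyadic_energy w < +oo)%E.
Proof.
pose y : R := 2 `^ (gamma - 2^-1).
have y0 : 0 < y by exact: powR_gt0.
have y1 : y < 1.
  rewrite /y -opprB powRN invf_lt1 ?powR_gt0//.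
  have : 1 `^ (2^-1 - gamma) < 2 `^ (2^-1 - gamma); last by rewrite powR1.
  by apply: gt0_ltr_powR; rewrite ?nnegrE ?ler0n ?subr_gt0// ltr1n.
have ysq : y ^+ 2 = rho^-1 ^+ 2 / 2.
  rewrite /y /rho powRN invrK -!powR_mulrn ?powR_ge0//.
  rewrite -[in X in _ = _ / X](powRr1 (ler0n R 2)) -powRN -!powRrM -powRD.
    by congr (_ `^ _); lra.
  by rewrite pnatr_eq0 implybT.
have [M HM] := linear_geometric_bounded y0 y1.
have M0 : 0 <= M by apply: le_trans (HM 0%N); rewrite expr0 mulr1.
pose a := 2 * expR (c ^+ 2 * T * M ^+ 2 / 2).
have bnd n : (\int[P]_w (g n w)%:E <= (a * 2^-1 ^+ n)%:E)%E.
  have -> : (\int[P]_w (g n w)%:E = \sum_(k < 2 ^ n)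
      \int[P]_w ((4^-1) ^+ n * expR (v n * `|incr n k w|))%:E)%E.
    rewrite -ge0_integral_sum//.
    - by apply: eq_integral => w _; rewrite sumEFin.
    - by move=> k; apply/measurable_EFinP; exact: mterm.
  apply: (@le_trans _ _ (\sum_(k < 2 ^ n) (a * 4^-1 ^+ n)%:E)%E).
    apply: lee_sum => k _.
    under eq_integral do rewrite EFinM.
    have c4 : (0 <= (4^-1 ^+ n : R)%:E)%E by rewrite lee_fin exprn_ge0// invr_ge0.
    rewrite ge0_integralZl//; try (by apply/measurable_EFinP; exact: mexp);
      try (by move=> w _; rewrite lee_fin expR_ge0).
    rewrite mulrC EFinM lee_wpmul2l ?lee_fin ?exprn_ge0 ?invr_ge0//.
    apply: le_trans (gaussian_increment_exp_moment _ gW _ _) _.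
    - by rewrite divr_ge0// mulr_ge0// ltW.
    - by rewrite ltr_pM2r ?invr_gt0 ?exprn_gt0// ltr_pM2r// ltr_nat.
    rewrite lee_fin /a ler_pM2l// ler_expR ler_pM2r ?invr_gt0//.
    have -> : v n ^+ 2 * (k.+1%:R * T / 2 ^+ n - k%:R * T / 2 ^+ n) =
        c ^+ 2 * T * (n.+1%:R * y ^+ n) ^+ 2.
      have -> : (n.+1%:R * y ^+ n) ^+ 2 = n.+1%:R ^+ 2 * ((rho ^- n) ^+ 2 / 2 ^+ n).
        rewrite exprMn; congr (_ * _).
        by rewrite exprAC ysq exprMn exprAC !exprVn.
      by rewrite /v -[k.+1%:R]natr1; lra.
    rewrite ler_wpM2l ?mulr_ge0 ?sqr_ge0 ?(ltW T0) ?(ltW c0)//.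
    by rewrite ler_sqr ?nnegrE// mulr_ge0// exprn_ge0// ltW.
  rewrite sumEFin lee_fin sumr_const card_ord -[leLHS]mulr_natr natrX -mulrA -exprMn.
  by rewrite (_ : 4^-1 * 2 = 2^-1 :> R)//; lra.
rewrite integral_nneseries//; last by move=> n w _; rewrite lee_fin g_ge0.
apply: (@le_lt_trans _ _ (\sum_(n <oo) (a * 2^-1 ^+ n)%:E)%E).
  apply: lee_nneseries => // n _ _.
  by apply: integral_ge0 => w _; rewrite lee_fin g_ge0.
rewrite (@eq_eseriesr _ _ (fun k => ((2 * a) / (2 ^ (k + 1))%:R)%:E)); last first.
  by move=> n _; congr EFin; rewrite addn1 natrX exprS invfM exprVn; lra.
have := @cvg_geometric_eseries_half R (2 * a) 0.
by move=> /cvg_lim -> //; rewrite ltry.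
Qed.

(** Each term of the series is at most its sum; the logarithm of this inequality
    is linear in [n], and so is the weight [v n]. *)
Lemma dyadic_energy_incr w n k : (dyadic_energy w < +oo)%E -> (k < 2 ^ n)%N ->
  let K := (ln (fine (dyadic_energy w)) + ln 4) / c in
  [/\ 1 <= fine (dyadic_energy w), 0 <= K & `|incr n k w| <= K * rho ^+ n].
Proof.
move=> fin kn K; set G := fine (dyadic_energy w) in K *.
have GE : dyadic_energy w = G%:E by rewrite fineK// ge0_fin_numE// dyadic_energy_ge0.
have gG m : g m w <= G.
  rewrite -lee_fin -GE /dyadic_energy.
  rewrite (nneseries_split 0 m.+1)//; last by move=> i _; rewrite lee_fin g_ge0.
  rewrite add0n big_nat_recr//=.
  apply: (@le_trans _ _ (\sum_(0 <= i < m) (g i w)%:E + (g m w)%:E)%E).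
    by rewrite leeDr// sume_ge0// => i _; rewrite lee_fin g_ge0.
  by rewrite leeDl// nneseries_ge0// => i _ _; rewrite lee_fin g_ge0.
have tG m j : (j < 2 ^ m)%N -> (4^-1) ^+ m * expR (v m * `|incr m j w|) <= G.
  move=> jm; apply: le_trans (gG m).
  rewrite /g (bigD1 (Ordinal jm))//= lerDl; apply: sumr_ge0 => i _.
  by apply: mulr_ge0; [rewrite exprn_ge0// invr_ge0|exact: expR_ge0].
have v0 m : 0 < v m by rewrite /v mulr_gt0 ?invr_gt0 ?exprn_gt0// mulr_gt0.
have G1 : 1 <= G.
  apply: le_trans (tG 0%N 0%N (ltn0Sn _)).
  by rewrite expr0 mul1r -{1}expR0 ler_expR mulr_ge0// ltW.
have lnG : 0 <= ln G by rewrite ln_ge0.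
have ln4 : 0 <= ln 4 :> R by rewrite ln_ge0// ler1n.
split => //; first by rewrite divr_ge0 ?addr_ge0 ?(ltW c0).
have : v n * `|incr n k w| <= ln G + n%:R * ln 4.
  have := tG n k kn.
  rewrite -ler_ln ?posrE ?(lt_le_trans _ G1) ?mulr_gt0 ?expR_gt0 ?exprn_gt0 ?invr_gt0//.
  rewrite lnM ?posrE ?expR_gt0 ?exprn_gt0 ?invr_gt0// expRK exprVn lnV ?posrE ?exprn_gt0//.
  by rewrite lnXn// mulr_natl; lra.
rewrite /v mulrAC ler_pdivrMr ?exprn_gt0// => h.
have h2 : ln G + n%:R * ln 4 <= (ln G + ln 4) * n.+1%:R.
  by rewrite -[n.+1%:R]natr1; have := mulr_ge0 (ler0n R n) lnG; lra.
have n1 : 0 < n.+1%:R :> R by [].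
rewrite -(ler_pM2r n1) -(ler_pM2l c0) mulrA (mulrAC c) (le_trans h)//.
rewrite /K; have -> : c * ((ln G + ln 4) / c * rho ^+ n * n.+1%:R) =
   (ln G + ln 4) * n.+1%:R * rho ^+ n * (c / c) by lra.
by rewrite divff ?gt_eqF// mulr1 ler_wpM2r// exprn_ge0// ltW.
Qed.

End HolderMoment.

(** [G] is a measurable majorant of [exp (c K)]: the Hoelder constant itself is
    not shown to be measurable.  Up to the constant [C] of the chaining, [K] is
    the logarithm of the energy plus [ln 4], whence the factor 4. *)
Lemma brownian_holder_constant {d} {Omega : measurableType d} {R : realType}
    (P : probability Omega R) (W : R -> {RV P >-> R}) (T gamma c : R) :
    0 < T -> 0 < gamma -> gamma < 2^-1 -> 0 < c -> brownian_motion W ->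
  exists G : Omega -> \bar R, [/\ measurable_fun setT G,
    forall w, (0 <= G w)%E, (\int[P]_w G w < +oo)%E &
    {ae P, forall w, {within `[0, +oo[, continuous (fun t => W t w)} /\
      ((G w < +oo)%E -> exists K : R, [/\ 0 <= K, ((expR (c * K))%:E <= G w)%E &
        forall s t, 0 <= s <= T -> 0 <= t <= T ->
          `|W t w - W s w| <= K * `|t - s| `^ gamma])}].
Proof.
move=> T0 g0 g1 c0 [_ _ gW cW].
pose rho : R := 2 `^ (- gamma).
pose C := (1 + 2 * (rho / (1 - rho))) * (2 / T) `^ gamma.
have rho0 : 0 < rho by exact: powR_gt0.
have rho1 : rho < 1.
  rewrite /rho powRN invf_lt1 ?powR_gt0//.
  have : 1 `^ gamma < 2 `^ gamma; last by rewrite powR1.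
  by apply: gt0_ltr_powR; rewrite ?nnegrE ?ler0n// ltr1n.
have C0 : 0 < C.
  rewrite mulr_gt0 ?powR_gt0 ?divr_gt0//.
  by rewrite ltr_wpDr// mulr_ge0// divr_ge0 ?(ltW rho0)// subr_ge0 ltW.
have cC : 0 < c * C by exact: mulr_gt0.
exists (fun w => (4%:E * dyadic_energy W T gamma (c * C) w)%E); split.
- by apply: emeasurable_funM => //; exact: measurable_dyadic_energy.
- by move=> w; rewrite mule_ge0// dyadic_energy_ge0.
- rewrite ge0_integralZl//; last 2 first.
  + exact: measurable_dyadic_energy.
  + by move=> w _; exact: dyadic_energy_ge0.
  rewrite lte_mul_pinfty//; first exact: integral_dyadic_energy.
- apply: filterS cW => w cw; split => //.
  set E := dyadic_energy _ _ _ _ _ => finG.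
  have finE : (E < +oo)%E.
    rewrite ltNge leye_eq; apply/negP => /eqP Eoo; move: finG.
    by rewrite Eoo gt0_muley// lte_fin.
  pose K := (ln (fine E) + ln 4) / (c * C).
  have [E1 K0 _] := dyadic_energy_incr cC finE (ltn0Sn 0 : (0 < 2 ^ 0)%N).
  exists (K * C); split.
  + by rewrite mulr_ge0// ltW.
  + have -> : c * (K * C) = ln (fine E) + ln 4.
      by rewrite mulrCA /K divfK// gt_eqF.
    have EE : E = (fine E)%:E by rewrite fineK// ge0_fin_numE// dyadic_energy_ge0.
    rewrite expRD [X in (_ <= _ * X)%E]EE -EFinM lee_fin [4 * _]mulrC.
    by rewrite !lnK ?posrE// (lt_le_trans _ E1).
  + move=> s t sT tT; rewrite /C mulrA.
    apply: (@dyadic_holder R (fun t => W t w) T gamma K) => // n k kn.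
    by have [_ _] := dyadic_energy_incr cC finE kn.
Qed.

(** * Expected distance *)

Import HBNNSimple.
Section Expectation.
Context {d : measure_display} {Omega : measurableType d} {R : realType}.
Variable mu : {measure set Omega -> \bar R}.
Local Open Scope ereal_scope.

(** The integral of a nonnegative function is the supremum of the integrals of
    the simple functions below it, and these are measurable.  This gives access
    to the expectation of the Skorohod distance, an infimum over an uncountable
    family, through a measurable majorant. *)
Lemma ae_le_integral_upper (f g : Omega -> \bar R) : (forall x, 0 <= f x) ->
    measurable_fun setT g -> (forall x, 0 <= g x) ->
    {ae mu, forall x, f x <= g x} ->
  \int[mu]_x f x <= \int[mu]_x g x.
Proof.
move=> f0 mg g0 fg; rewrite ge0_integralTE//.
apply: ge_ereal_sup => _ [u uf <-]; rewrite -integralT_nnsfun.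
apply: ae_ge0_le_integral => //.
- by move=> x _; rewrite lee_fin.
- apply/measurable_EFinP; exact: measurable_funP.
- by apply: filterS fg => x fgx _; exact: le_trans (uf x) fgx.
Qed.

End Expectation.

Section MeanError.
Context {R : realType}.

Lemma skorohod_ge0 (T : R) (x1 x2 : R -> plane) : 0 <= T -> (0 <= skorohod T x1 x2)%E.
Proof.
move=> T0; apply: le_ereal_inf_tmp => _ [lam _ <-].
rewrite le_max; apply/orP; right.
apply: (@le_trans _ _ (euclidean_norm (x1 0 - x2 (lam 0)))%:E).
  by rewrite lee_fin sqrtr_ge0.
by apply: ereal_sup_ubound; exists 0 => //=; rewrite in_itv/= lexx.
Qed.

Lemma common_bound (f1 f2 : R -> R) : bounded_fct f1 -> bounded_fct f2 ->
  exists M, (forall x, `|f1 x| <= M) /\ (forall x, `|f2 x| <= M).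
Proof.
move=> [M1 f1M] [M2 f2M]; exists (Num.max M1 M2).
by split=> x; rewrite le_max ?f1M ?f2M ?orbT.
Qed.

(** The larger of the two Hoelder constants serves both Brownian paths, and its
    exponential is at most the sum of the two majorants.  Where one of these is
    infinite the bound is trivial. *)
Lemma mean_skorohod_bound {d : measure_display} {Omega : measurableType d}
    (P : probability Omega R) (W B : R -> {RV P >-> R})
    (b h : R -> R) (p alpha r0 : R) (N : nat) (T : R) (r theta : R -> R)
    (Reps Thetaeps : R -> R -> {RV P >-> R}) (R1 : R -> {RV P >-> R}) (gamma : R) :
    brownian_motion W -> brownian_motion B -> drift_function b -> reset_function h ->
    0 < p -> 0 < alpha -> 0 <= r0 -> N%:R * alpha < T -> T < N.+1%:R * alpha ->
    deterministic_solution b h alpha r0 r theta ->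
    (forall eps, 0 < eps -> eps < 1 ->
     {ae P, forall w, perturbed_solution b h alpha r0 p eps
                        (fun t => W t w) (fun t => B t w)
                        (fun t => Reps eps t w)
                        (fun t => Thetaeps eps t w)}) ->
    {ae P, forall w, fluctuation_solution b h alpha r
                     (fun t => W t w) (fun t => R1 t w)} ->
    0 < gamma -> gamma < 2^-1 ->
  exists2 C : R, 0 < C & forall eps, 0 < eps -> eps < 1 ->
    (\int[P]_w skorohod T
       (planar_path (fun t => Reps eps t w) (fun t => Thetaeps eps t w))
       (fun t => (planar_path r theta t +
                  eps *: planar_path (fun t => R1 t w) (fun=> 0) t)%R) <=
     (C * error_rate eps p gamma)%:E)%E.
Proof.
move=> bW bB [db bb bb1 bb2] [_ h0 _ hreg] p0 alpha0 r00 NT TN det sol fl gamma0 gamma2.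
have [dh _ bh1] := hreg 0%N isT; have [dh1 _ bh2] := hreg 1%N isT.
have [M1 [bM1 b1M1]] := common_bound bb bb1.
have [M2 [h1M2 h2M2]] := common_bound bh1 bh2.
have [M3 b2M3] := bb2.
pose M := Num.max (Num.max M1 M2) M3.
have M1M : M1 <= M by rewrite /M !le_max lexx.
have M2M : M2 <= M by rewrite /M !le_max lexx orbT.
have M3M : M3 <= M by rewrite /M !le_max lexx orbT.
have T0 : 0 < T by apply: le_lt_trans NT; rewrite mulr_ge0// ltW.
have gamma1 : gamma <= 1 by lra.
have [c [C [c0 C0 bound]]] := pathwise_bound (db 0%N) (db 1%N) dh dh1
  (fun x => le_trans (bM1 x) M1M) (fun x => le_trans (b1M1 x) M1M)
  (fun x => le_trans (b2M3 x) M3M) (fun x => le_trans (h1M2 x) M2M)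
  (fun x => le_trans (h2M2 x) M2M) h0 alpha0 NT TN det r00 p0 gamma0 gamma1.
have [GW [mGW GW0 iGW holdW]] := brownian_holder_constant T0 gamma0 gamma2 c0 bW.
have [GB [mGB GB0 iGB holdB]] := brownian_holder_constant T0 gamma0 gamma2 c0 bB.
pose I := (\int[P]_w GW w + \int[P]_w GB w)%E.
have I0 : (0 <= I)%E by apply: adde_ge0; apply: integral_ge0 => w _.
have Ifin : I \is a fin_num by rewrite ge0_fin_numE// lte_add_pinfty.
exists (C * fine I + 1); first by rewrite ltr_wpDl// mulr_ge0 ?(ltW C0)// fine_ge0.
move=> eps eps0 eps1; have [_ _ _ e0] := error_rate_ge eps p gamma.
have epos : 0 < error_rate eps p gamma.
  by apply: lt_le_trans (powR_gt0 p eps0) _; have [] := error_rate_ge eps p gamma.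
have Cepos : 0 < C * error_rate eps p gamma by exact: mulr_gt0.
have Ce0 := ltW Cepos.
have mG : measurable_fun setT (fun w => GW w + GB w)%E by exact: emeasurable_funD.
have G0 w : (0 <= GW w + GB w)%E by exact: adde_ge0.
apply: (@le_trans _ _ (\int[P]_w ((C * error_rate eps p gamma)%:E * (GW w + GB w)))%E).
  apply: ae_le_integral_upper.
  - by move=> w; apply: skorohod_ge0; exact: ltW.
  - exact: measurable_funeM.
  - by move=> w; rewrite mule_ge0// lee_fin.
  - near=> w.
    have [cW hW] : {within `[0, +oo[, continuous (fun t => W t w)} /\
      ((GW w < +oo)%E -> exists K : R, [/\ 0 <= K, ((expR (c * K))%:E <= GW w)%E &
        forall s t, 0 <= s <= T -> 0 <= t <= T ->
          `|W t w - W s w| <= K * `|t - s| `^ gamma]) by near: w.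
    have [cB hB] : {within `[0, +oo[, continuous (fun t => B t w)} /\
      ((GB w < +oo)%E -> exists K : R, [/\ 0 <= K, ((expR (c * K))%:E <= GB w)%E &
        forall s t, 0 <= s <= T -> 0 <= t <= T ->
          `|B t w - B s w| <= K * `|t - s| `^ gamma]) by near: w.
    have solw : perturbed_solution b h alpha r0 p eps
       (fun t => W t w) (fun t => B t w)
       (fun t => Reps eps t w) (fun t => Thetaeps eps t w) by near: w; exact: sol.
    have flw : fluctuation_solution b h alpha r (fun t => W t w) (fun t => R1 t w).
      by near: w.
    have pinf : ((C * error_rate eps p gamma)%:E * +oo = +oo)%E by rewrite gt0_muley// lte_fin.
    have [GWfin|] := ltP (GW w) +oo%E; last first.
      by rewrite leye_eq => /eqP ->; rewrite addye ?pinf ?leey// gt_eqF// (lt_le_trans ltNy0).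
    have [GBfin|] := ltP (GB w) +oo%E; last first.
      by rewrite leye_eq => /eqP ->; rewrite addey ?pinf ?leey// gt_eqF// (lt_le_trans ltNy0).
    have [KW [KW0 KWG WH]] := hW GWfin; have [KB [KB0 KBG BH]] := hB GBfin.
    pose K := Num.max KW KB.
    have KWK : KW <= K by rewrite le_max lexx.
    have KBK : KB <= K by rewrite le_max lexx orbT.
    have K0 : 0 <= K by exact: le_trans KWK.
    have KG : ((expR (c * K))%:E <= GW w + GB w)%E.
      rewrite /K; case: (leP KW KB) => _.
        by apply: le_trans KBG _; rewrite leeDr.
      by apply: le_trans KWG _; rewrite leeDl.
    have WK s t : 0 <= s <= T -> 0 <= t <= T -> `|W t w - W s w| <= K * `|t - s| `^ gamma.
      by move=> sT tT; apply: le_trans (WH s t sT tT) _; rewrite ler_wpM2r ?powR_ge0.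
    have BK s t : 0 <= s <= T -> 0 <= t <= T -> `|B t w - B s w| <= K * `|t - s| `^ gamma.
      by move=> sT tT; apply: le_trans (BH s t sT tT) _; rewrite ler_wpM2r ?powR_ge0.
    apply: le_trans (bound eps K _ _ _ _ _ eps0 eps1 K0 cW cB WK BK solw flw) _.
    by rewrite EFinM lee_wpmul2l// lee_fin.
rewrite ge0_integralZl//.
rewrite ge0_integralD//= -/I -(fineK Ifin) -EFinM lee_fin.
by rewrite mulrAC ler_wpM2r// lerDl.
Unshelve. all: by end_near. Qed.

End MeanError.

Theorem theorem2p6 (R : realType) (d : measure_display)
    (Omega : measurableType d) (P : probability Omega R)
    (W B : R -> {RV P >-> R})
    (b h : R -> R) (p nu alpha r0 : R) (N : nat) (T : R)
    (r theta : R -> R)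
    (Reps Thetaeps : R -> R -> {RV P >-> R})
    (R1 : R -> {RV P >-> R}) :
  brownian_motion W -> brownian_motion B -> independent_processes W B ->
  drift_function b -> reset_function h ->
  1 < p -> 1 < nu -> nu < p ->
  0 < alpha -> alpha < 2 * pi ->
  0 < r0 ->
  N%:R * alpha < T -> T < N.+1%:R * alpha ->
  deterministic_solution b h alpha r0 r theta ->
  (forall eps, 0 < eps -> eps < 1 ->
     {ae P, forall w, perturbed_solution b h alpha r0 p eps
                        (fun t => W t w) (fun t => B t w)
                        (fun t => Reps eps t w)
                        (fun t => Thetaeps eps t w)}) ->
  {ae P, forall w, fluctuation_solution b h alpha r
                     (fun t => W t w) (fun t => R1 t w)} ->
  let x := planar_path r theta in
  let X eps w := planar_path (fun t => Reps eps t w)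
                             (fun t => Thetaeps eps t w) in
  let Z w := planar_path (fun t => R1 t w) (fun=> 0) in
  let Err eps := (\int[P]_w
    skorohod T (X eps w) (fun t => (x t + eps *: Z w t)%R))%E in
  exists2 C : R, 0 < C &
    \forall eps \near (0 : R)^'+,
      (p <= 2 -> (Err eps <= (C * eps `^ nu)%:E)%E) /\
      (2 < nu -> (Err eps <= (C * eps ^+ 2)%:E)%E).
Proof.
move=> bW bB _ bdrift hreset p1 nu1 nup alpha0 _ r00 NT TN det sol fl x X Z Err.
have p0 : 0 < p by apply: lt_trans p1.
have mean gamma := mean_skorohod_bound bW bB bdrift hreset p0 alpha0 (ltW r00) NT TN det sol fl
  (gamma := gamma).
have [p2|p2] := leP p 2.
  (* this exponent gives 1 + p gamma = nu; it is below 1/2 since nu < p <= 2 *)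
  have g0 : 0 < (nu - 1) / p by rewrite divr_gt0// subr_gt0.
  have g2 : (nu - 1) / p < 2^-1 by rewrite ltr_pdivrMr//; lra.
  have [C C0 bound] := mean _ g0 g2.
  exists (3 * C); first by rewrite mulr_gt0.
  near=> eps.
  have eps0 : 0 < eps by near: eps; exact: nbhs_right_gt.
  have eps1 : eps < 1 by near: eps; exact: nbhs_right_lt.
  split=> [_|nu2]; last by move: (lt_trans nu2 nup); rewrite ltNge p2.
  apply: le_trans (bound eps eps0 eps1) _; rewrite lee_fin /error_rate.
  have -> : 1 + p * ((nu - 1) / p) = nu by rewrite mulrC divfK ?gt_eqF//; lra.
  have e01 : 0 < eps <= 1 by rewrite eps0 ltW.
  have ep : eps `^ p <= eps `^ nu by apply: ger_powR => //; exact: ltW.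
  have e2 : eps ^+ 2 <= eps `^ nu.
    by rewrite -powR_mulrn ?(ltW eps0)//; apply: ger_powR => //; apply: ltW; exact: lt_le_trans p2.
  by rewrite -mulrA mulrCA ler_pM2l//; lra.
(* this exponent gives 1 + p gamma = 2 *)
have g0 : 0 < p^-1 by rewrite invr_gt0.
have g2 : p^-1 < 2^-1 by rewrite ltf_pV2 ?posrE.
have [C C0 bound] := mean _ g0 g2.
exists (3 * C); first by rewrite mulr_gt0.
near=> eps.
have eps0 : 0 < eps by near: eps; exact: nbhs_right_gt.
have eps1 : eps < 1 by near: eps; exact: nbhs_right_lt.
split=> [//|_].
apply: le_trans (bound eps eps0 eps1) _; rewrite lee_fin /error_rate.
have e01 : 0 < eps <= 1 by rewrite eps0 ltW.
have e2E : eps `^ 2 = eps ^+ 2 by rewrite -powR_mulrn ?(ltW eps0).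
have -> : 1 + p * p^-1 = 2 by rewrite divff ?gt_eqF//; lra.
have : eps `^ p <= eps `^ 2 by apply: ger_powR => //; exact: ltW.
by rewrite e2E -mulrA mulrCA ler_pM2l//; lra.
Unshelve. all: by end_near. Qed.
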